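(* Let $l_1=0$, $l_2\in\{1,-1\}$. Then $$\mathrm{Aut}(BMG)\cong\mathrm{Der}\big(\mathbb Z^2,\mathcal R_3(\mathbb Z)\big)\rtimes\big(U(\mathcal R_3(\mathbb Z))\rtimes\mathcal K\big),$$ where $$\mathcal K=\left\{\begin{pmatrix}1&0\\0&1\end{pmatrix},\begin{pmatrix}-1&-1\\0&1\end{pmatrix}\right\}\ \text{ if } l_2=1,\qquad \mathcal K=\left\{\begin{pmatrix}1&0\\0&1\end{pmatrix},\begin{pmatrix}1&0\\-1&-1\end{pmatrix}\right\}\ \text{ if } l_2=-1.$$
   Context: Baumslag's metabelian group is $BMG=\langle a,s,t\mid st=ts,\ [a,a^t],\ aa^s=a^t\rangle$ (with $a^g=gag^{-1}$). For $l_1=0$ and either choice $l_2=\pm1$, it is isomorphic to $\mathcal R_3(\mathbb Z)\rtimes\mathbb Z^2$, where $\mathcal R_3(\mathbb Z)=\mathbb Z[t,(t+l_1)^{-1},(t+l_2)^{-1}]$ (localization of the polynomial ring $\mathbb Z[t]$) and $\mathbf v=(v_1,v_2)\in\mathbb Z^2$ acts on the additive group $\mathcal R_3(\mathbb Z)$ by $P^{\mathbf v}=P\,t^{v_1}(t+l_2)^{v_2}$. $U(\cdot)$ denotes the group of units of a ring. $\mathrm{Der}(\mathbb Z^2,\mathcal R_3(\mathbb Z))$ is the additive group of maps $\delta:\mathbb Z^2\to\mathcal R_3(\mathbb Z)$ with $\delta(\mathbf v+\mathbf w)=\delta(\mathbf v)+\delta(\mathbf w)^{\mathbf v}$. Elements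 $\beta\in\mathcal K\subset\mathrm{Aut}(\mathbb Z^2)$ are given by matrices $(b_{i,j})$ with respect to the standard basis ($\beta(\mathbf e_j)=\sum_k b_{k,j}\mathbf e_k$). Each $\beta\in\mathcal K$ acts on $\mathcal R_3(\mathbb Z)$ by the ring automorphism $S\mapsto S^\beta$ sending $t^{v_1}(t+l_2)^{v_2}$ to $t^{w_1}(t+l_2)^{w_2}$ with $\mathbf w=\beta(\mathbf v)$. In $U(\mathcal R_3(\mathbb Z))\rtimes\mathcal K$ the product is $(R,\beta)(S,\gamma)=(RS^\beta,\beta\gamma)$. This group acts on derivations by $\delta^{(R,\beta)}=\alpha_{R,\beta}\circ\delta\circ\beta^{-1}$, where $\alpha_{R,\beta}(S)=RS^\beta$. *)

(* Defs.v *)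
From HB Require Import structures.
From mathcomp Require Import all_boot all_order all_algebra fraction.
From mathcomp Require Import monoid.
From mathcomp Require Import boolp.

Set Implicit Arguments.
Unset Strict Implicit.
Unset Printing Implicit Defensive.

Import Order.TTheory GRing.Theory Num.Theory.

Local Open Scope ring_scope.
Local Open Scope quotient_scope.

Definition isomorphic_groups (G H : groupType) : Prop :=
  exists f : {multiplicative G -> H}, bijective f.

(* The letter (i, false) is the generator i, the letter (i, true) its inverse. *)
Notation word I := (seq (I * bool)).

Definition inv_letter (I : choiceType) (x : I * bool) : I * bool := (x.1, ~~ x.2).
Definition inv_word (I : choiceType) (w : word I) : word I :=
  rev (map (@inv_letter I) w).

Inductive pres_eq (I : choiceType) (rels : seq (word I * word I)) :
    word I -> word I -> Prop :=
| pres_rel r : r \in rels -> pres_eq rels r.1 r.2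
| pres_inv x : pres_eq rels [:: x; inv_letter x] [::]
| pres_refl u : pres_eq rels u u
| pres_sym u v : pres_eq rels u v -> pres_eq rels v u
| pres_trans u v w : pres_eq rels u v -> pres_eq rels v w -> pres_eq rels u w
| pres_cat u u' v v' : pres_eq rels u u' -> pres_eq rels v v' ->
    pres_eq rels (u ++ v) (u' ++ v').

Section PresentedGroup.
Variables (I : choiceType) (rels : seq (word I * word I)).
Implicit Types u v w : word I.

Definition pres_eqb u v : bool := `[< pres_eq rels u v >].

Lemma pres_eqb_refl : reflexive pres_eqb.
Proof. by move=> u; apply/asboolP; exact: pres_refl. Qed.
Lemma pres_eqb_sym : symmetric pres_eqb.
Proof. by move=> u v; apply/asboolP/asboolP; exact: pres_sym. Qed.
Lemma pres_eqb_trans : transitive pres_eqb.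
Proof.
by move=> v u w /asboolP uv /asboolP vw; apply/asboolP; exact: pres_trans vw.
Qed.
Canonical pres_equiv := EquivRel pres_eqb pres_eqb_refl pres_eqb_sym pres_eqb_trans.

Definition presented := {eq_quot pres_equiv}.
HB.instance Definition _ := Choice.on presented.
HB.instance Definition _ := EqQuotient.on presented.

Lemma pres_piE u v : pres_eq rels u v <-> \pi_presented u = \pi_presented v.
Proof.
split=> [uv|/eqP]; first by apply/eqP; rewrite eqmodE; apply/asboolP.
by rewrite eqmodE => /asboolP.
Qed.

Lemma pres_repr u : pres_eq rels (repr (\pi_presented u)) u.
Proof. by apply/pres_piE; rewrite reprK. Qed.

Lemma inv_letterK : involutive (@inv_letter I).
Proof. by case=> i b; rewrite /inv_letter /= negbK. Qed.

Lemma inv_wordK : involutive (@inv_word I).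
Proof.
move=> u; rewrite /inv_word map_rev revK -map_comp -[RHS]map_id.
by apply: eq_map => x /=; rewrite inv_letterK.
Qed.

Lemma pres_mulV u : pres_eq rels (u ++ inv_word u) [::].
Proof.
elim: u => [|x u IHu]; first exact: pres_refl.
rewrite /inv_word map_cons rev_cons -cats1 -cat1s -catA (catA u).
apply: pres_trans (pres_inv rels x).
rewrite -[[:: x; _]]/([:: x] ++ [::] ++ [:: inv_letter x]).
apply: pres_cat; first exact: pres_refl.
by apply: pres_cat => //; exact: pres_refl.
Qed.

Lemma pres_Vmul u : pres_eq rels (inv_word u ++ u) [::].
Proof. by have := pres_mulV (inv_word u); rewrite inv_wordK. Qed.

Lemma pres_inv_word u v : pres_eq rels u v -> pres_eq rels (inv_word u) (inv_word v).
Proof.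
move=> uv; apply: (@pres_trans _ _ _ (inv_word u ++ v ++ inv_word v)).
  rewrite -[X in pres_eq _ X _]cats0; apply: pres_cat; first exact: pres_refl.
  by apply: pres_sym; exact: pres_mulV.
rewrite catA -[X in pres_eq _ _ X]cat0s; apply: pres_cat; last exact: pres_refl.
apply: pres_trans (pres_Vmul u); apply: pres_cat; first exact: pres_refl.
exact: pres_sym.
Qed.

Definition presented_mul (x y : presented) : presented := \pi_presented (repr x ++ repr y).
Definition presented_inv (x : presented) : presented := \pi_presented (inv_word (repr x)).
Definition presented_one : presented := \pi_presented [::].

Lemma presented_mulE u v :
  presented_mul (\pi u) (\pi v) = \pi_presented (u ++ v).
Proof. by apply/pres_piE; apply: pres_cat; exact: pres_repr. Qed.

Lemma presented_invE u : presented_inv (\pi u) = \pi_presented (inv_word u).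
Proof. by apply/pres_piE; apply: pres_inv_word; exact: pres_repr. Qed.

Lemma presented_mulA : associative presented_mul.
Proof.
by elim/quotW=> u; elim/quotW=> v; elim/quotW=> w; rewrite !presented_mulE catA.
Qed.
Lemma presented_mul1 : left_id presented_one presented_mul.
Proof. by elim/quotW=> u; rewrite presented_mulE cat0s. Qed.
Lemma presented_mulr1 : right_id presented_one presented_mul.
Proof. by elim/quotW=> u; rewrite presented_mulE cats0. Qed.
Lemma presented_mulV : left_inverse presented_one presented_inv presented_mul.
Proof.
elim/quotW=> u; rewrite presented_invE presented_mulE.
by apply/pres_piE; exact: pres_Vmul.
Qed.
Lemma presented_mulVr : right_inverse presented_one presented_inv presented_mul.
Proof.
elim/quotW=> u; rewrite presented_invE presented_mulE.
by apply/pres_piE; exact: pres_mulV.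
Qed.

HB.instance Definition _ := isGroup.Build presented
  presented_mulA presented_mul1 presented_mulr1 presented_mulV presented_mulVr.

End PresentedGroup.

Definition BMG_a : word 'I_3 := [:: (inord 0, false)].
Definition BMG_s : word 'I_3 := [:: (inord 1, false)].
Definition BMG_t : word 'I_3 := [:: (inord 2, false)].

(* a^g = g a g^-1, unlike the library's x ^ y = y^-1 x y. *)
Definition conj_word (I : choiceType) (x g : word I) : word I :=
  g ++ x ++ inv_word g.
Definition comm_word (I : choiceType) (x y : word I) : word I :=
  x ++ y ++ inv_word x ++ inv_word y.

Definition BMG_rels : seq (word 'I_3 * word 'I_3) :=
  [:: (BMG_s ++ BMG_t, BMG_t ++ BMG_s);
      (comm_word BMG_a (conj_word BMG_a BMG_t), [::]);
      (BMG_a ++ conj_word BMG_a BMG_s, conj_word BMG_a BMG_t)].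

Definition BMG : groupType := presented BMG_rels.

Section AutomorphismGroup.
Variable G : groupType.
Local Open Scope group_scope.

Record autg : Type := Autg {
  autg_fun :> G -> G;
  _ : `[< bijective autg_fun /\ {morph autg_fun : x y / x * y} >] }.
HB.instance Definition _ := [isSub for autg_fun].
HB.instance Definition _ := [Choice of autg by <:].

Lemma autgP (f g : autg) : (forall x, f x = g x) -> f = g.
Proof. by move=> fg; apply/val_inj/funext. Qed.
Lemma autg_bij (f : autg) : bijective f.
Proof. by case: f => f /= /asboolP[]. Qed.
Lemma autgM (f : autg) : {morph f : x y / x * y}.
Proof. by case: f => f /= /asboolP[]. Qed.

Lemma autg_one_subproof :
  `[< bijective (@id G) /\ {morph @id G : x y / x * y} >].
Proof. by apply/asboolP; split=> //; exists id. Qed.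
Definition autg_one := Autg autg_one_subproof.

Lemma autg_mul_subproof (f g : autg) :
  `[< bijective (f \o g) /\ {morph f \o g : x y / x * y} >].
Proof.
apply/asboolP; split; first by apply: bij_comp; exact: autg_bij.
by move=> x y /=; rewrite !autgM.
Qed.
Definition autg_mul (f g : autg) := Autg (autg_mul_subproof f g).

Lemma autg_inv_ex (f : autg) : exists g : autg, cancel f g /\ cancel g f.
Proof.
have [g fK gK] := autg_bij f.
have gP : `[< bijective g /\ {morph g : x y / x * y} >].
  apply/asboolP; split; first by exists f.
  by move=> x y; apply: (can_inj fK); rewrite autgM !gK.
by exists (Autg gP).
Qed.
Definition autg_inv (f : autg) : autg := projT1 (cid (autg_inv_ex f)).
Lemma autg_invK (f : autg) : cancel (autg_inv f) f.
Proof. by rewrite /autg_inv; case: cid => g []. Qed.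
Lemma autgK (f : autg) : cancel f (autg_inv f).
Proof. by rewrite /autg_inv; case: cid => g []. Qed.

Lemma autg_mulA : associative autg_mul.
Proof. by move=> f g h; apply: autgP. Qed.
Lemma autg_mul1 : left_id autg_one autg_mul.
Proof. by move=> f; apply: autgP. Qed.
Lemma autg_mulr1 : right_id autg_one autg_mul.
Proof. by move=> f; apply: autgP. Qed.
Lemma autg_mulV : left_inverse autg_one autg_inv autg_mul.
Proof. by move=> f; apply: autgP => x /=; rewrite autgK. Qed.
Lemma autg_mulVr : right_inverse autg_one autg_inv autg_mul.
Proof. by move=> f; apply: autgP => x /=; rewrite autg_invK. Qed.

HB.instance Definition _ := isGroup.Build autg
  autg_mulA autg_mul1 autg_mulr1 autg_mulV autg_mulVr.

End AutomorphismGroup.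

Record group_action (H N : groupType) : Type := GroupAction {
  gact :> H -> N -> N;
  gact1 : forall n, gact 1%g n = n;
  gactM : forall h k n, gact (h * k)%g n = gact h (gact k n);
  gactMr : forall h m n, gact h (m * n)%g = (gact h m * gact h n)%g }.

Definition sdprod (H N : groupType) (act : group_action H N) : Type := (N * H)%type.

Section SemidirectProduct.
Variables (H N : groupType) (act : group_action H N).
Local Open Scope group_scope.

HB.instance Definition _ := Choice.copy (sdprod act) (N * H)%type.

Definition sdprod_mul (x y : sdprod act) : sdprod act :=
  (x.1 * act x.2 y.1, x.2 * y.2).
Definition sdprod_one : sdprod act := (1, 1).
Definition sdprod_inv (x : sdprod act) : sdprod act :=
  (act x.2^-1 x.1^-1, x.2^-1).

Lemma gactr1 h : act h 1 = 1.
Proof. by apply: (mulgI (act h 1)); rewrite -gactMr !mulg1. Qed.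

Lemma sdprod_mulA : associative sdprod_mul.
Proof.
by move=> [m h] [n k] [p l]; rewrite /sdprod_mul /= gactMr gactM !mulgA.
Qed.
Lemma sdprod_mul1 : left_id sdprod_one sdprod_mul.
Proof. by move=> [m h]; rewrite /sdprod_mul /= gact1 !mul1g. Qed.
Lemma sdprod_mulr1 : right_id sdprod_one sdprod_mul.
Proof. by move=> [m h]; rewrite /sdprod_mul /= gactr1 !mulg1. Qed.
Lemma sdprod_mulV : left_inverse sdprod_one sdprod_inv sdprod_mul.
Proof.
by move=> [m h]; rewrite /sdprod_mul /sdprod_inv /= -gactMr !mulVg gactr1.
Qed.
Lemma sdprod_mulVr : right_inverse sdprod_one sdprod_inv sdprod_mul.
Proof.
by move=> [m h]; rewrite /sdprod_mul /sdprod_inv /= -gactM !mulgV gact1 mulgV.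
Qed.

HB.instance Definition _ := isGroup.Build (sdprod act)
  sdprod_mulA sdprod_mul1 sdprod_mulr1 sdprod_mulV sdprod_mulVr.

End SemidirectProduct.

Section UnitGroup.
Variable A : comUnitRingType.

Record unitg : Type := Unitg { unitg_val : A; _ : unitg_val \is a GRing.unit }.
HB.instance Definition _ := [isSub for unitg_val].
HB.instance Definition _ := [Choice of unitg by <:].

Lemma unitgP (x : unitg) : unitg_val x \is a GRing.unit.
Proof. by case: x. Qed.

Lemma unitg_mul_subproof (x y : unitg) : unitg_val x * unitg_val y \is a GRing.unit.
Proof. by rewrite unitrM !unitgP. Qed.
Lemma unitg_inv_subproof (x : unitg) : (unitg_val x)^-1 \is a GRing.unit.
Proof. by rewrite unitrV unitgP. Qed.
Definition unitg_one := Unitg (@unitr1 A).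
Definition unitg_mul x y := Unitg (unitg_mul_subproof x y).
Definition unitg_inv x := Unitg (unitg_inv_subproof x).

Lemma unitg_mulA : associative unitg_mul.
Proof. by move=> x y z; apply: val_inj; rewrite /= mulrA. Qed.
Lemma unitg_mul1 : left_id unitg_one unitg_mul.
Proof. by move=> x; apply: val_inj; rewrite /= mul1r. Qed.
Lemma unitg_mulr1 : right_id unitg_one unitg_mul.
Proof. by move=> x; apply: val_inj; rewrite /= mulr1. Qed.
Lemma unitg_mulV : left_inverse unitg_one unitg_inv unitg_mul.
Proof. by move=> x; apply: val_inj; rewrite /= mulVr // unitgP. Qed.
Lemma unitg_mulVr : right_inverse unitg_one unitg_inv unitg_mul.
Proof. by move=> x; apply: val_inj; rewrite /= mulrV // unitgP. Qed.

HB.instance Definition _ := isGroup.Build unitg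
  unitg_mulA unitg_mul1 unitg_mulr1 unitg_mulV unitg_mulVr.

End UnitGroup.

Definition R3den (l1 l2 : int) (i j : nat) : {poly int} :=
  ('X + l1%:P) ^+ i * ('X + l2%:P) ^+ j.

(* The localization is realized inside the fraction field of Z[t]. *)
Definition R3pred (l1 l2 : int) : {pred {fraction {poly int}}} :=
  fun x => `[< exists p i j, x = FracField.tofrac p / FracField.tofrac (R3den l1 l2 i j) >].

Lemma sub_fracE (F : fieldType) (a b c d : F) : b != 0 -> d != 0 ->
  a / b - c / d = (a * d - c * b) / (b * d).
Proof. by move=> b0 d0; rewrite -mulNr addf_div // mulNr. Qed.

Section R3.
Variables l1 l2 : int.
Local Notation "x %:F" := (FracField.tofrac x).
Local Notation den := (R3den l1 l2).

Lemma R3den_neq0 i j : (den i j)%:F != 0.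
Proof.
rewrite tofrac_eq0; apply: monic_neq0.
by rewrite monicMr monic_exp // monicXaddC.
Qed.

Lemma R3denM i j i' j' : den i j * den i' j' = den (i + i') (j + j').
Proof. by rewrite /R3den !exprD mulrACA. Qed.

Fact R3_subring : subring_closed (R3pred l1 l2).
Proof.
split=> [|x y /asboolP[p [i [j ->]]] /asboolP[q [i' [j' ->]]]
         |x y /asboolP[p [i [j ->]]] /asboolP[q [i' [j' ->]]]]; apply/asboolP.
- by exists 1, 0%N, 0%N; rewrite /R3den !expr0 mulr1 divr1.
- exists (p * den i' j' - q * den i j), (i + i')%N, (j + j')%N.
  by rewrite -R3denM sub_fracE ?R3den_neq0 // -!tofracM -tofracB.
- exists (p * q), (i + i')%N, (j + j')%N.
  by rewrite -R3denM mulf_div -!tofracM.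
Qed.
HB.instance Definition _ :=
  GRing.isSubringClosed.Build _ (R3pred l1 l2) R3_subring.

Record R3 : Type := MkR3 { R3val : {fraction {poly int}}; _ : R3val \in R3pred l1 l2 }.
HB.instance Definition _ := [isSub for R3val].
HB.instance Definition _ := [Choice of R3 by <:].
HB.instance Definition _ := [SubChoice_isSubComNzRing of R3 by <:].

Lemma R3valM (x y : R3) : R3val (x * y) = R3val x * R3val y. Proof. by []. Qed.
Lemma R3valB (x y : R3) : R3val (x - y) = R3val x - R3val y.
Proof. exact: (rmorphB (val : R3 -> _)). Qed.
Lemma R3val1 : R3val 1 = 1. Proof. by []. Qed.
Lemma R3valP (x : R3) : R3val x \in R3pred l1 l2.
Proof. by case: x. Qed.

Definition R3unit : {pred R3} :=
  fun x => (R3val x != 0) && ((R3val x)^-1 \in R3pred l1 l2).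
Definition R3inv (x : R3) : R3 := if x \in R3unit then insubd x (R3val x)^-1 else x.

Fact R3_mulV : {in R3unit, left_inverse 1 R3inv *%R}.
Proof.
move=> x xU; rewrite /R3inv xU; case/andP: xU => x0 xV.
by apply: val_inj; rewrite [LHS]rmorphM /= val_insubd xV mulVf.
Qed.
Fact R3_unitP x y : y * x = 1 -> x \in R3unit.
Proof.
move=> /(congr1 R3val); rewrite R3valM R3val1 => yx.
have x0 : R3val x != 0.
  by apply/eqP=> x0; move/eqP: yx; rewrite x0 mulr0 eq_sym oner_eq0.
apply/andP; split=> //; rewrite (_ : _^-1 = R3val y) ?R3valP //.
by rewrite -[LHS]mul1r -yx mulfK.
Qed.
Fact R3_inv_out : {in [predC R3unit], R3inv =1 id}.
Proof. by move=> x; rewrite inE /= /R3inv => /negbTE->. Qed.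

HB.instance Definition _ :=
  GRing.ComNzRing_hasMulInverse.Build R3 R3_mulV R3_unitP R3_inv_out.

Fact R3poly_subproof (p : {poly int}) : p%:F \in R3pred l1 l2.
Proof. by apply/asboolP; exists p, 0%N, 0%N; rewrite /R3den !expr0 mulr1 divr1. Qed.
Definition R3poly (p : {poly int}) : R3 := MkR3 (R3poly_subproof p).

Fact R3poly_is_zmod_morphism : zmod_morphism R3poly.
Proof. by move=> p q; apply: val_inj; rewrite -[RHS]/(R3val (_ - _)) R3valB /= tofracB. Qed.
Fact R3poly_is_monoid_morphism : monoid_morphism R3poly.
Proof.
split=> [|p q]; apply: val_inj; first exact: tofrac1.
by rewrite -[RHS]/(R3val (_ * _)) R3valM /= tofracM.
Qed.
HB.instance Definition _ := GRing.isZmodMorphism.Build _ _ R3poly R3poly_is_zmod_morphism.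
HB.instance Definition _ :=
  GRing.isMonoidMorphism.Build _ _ R3poly R3poly_is_monoid_morphism.

Definition R3t : R3 := R3poly 'X.

Lemma R3poly_horner p : R3poly p = (map_poly intr p).[R3t].
Proof.
elim/poly_ind: p => [|p c IHp]; first by rewrite !rmorph0 horner0.
rewrite !rmorphD !rmorphM /= map_polyX map_polyC !hornerE /= -IHp.
by congr (_ + _); rewrite -[c in LHS]intz !rmorph_int.
Qed.

Lemma R3den_unit i j : R3poly (den i j) \is a GRing.unit.
Proof.
apply/andP; split; first exact: R3den_neq0.
by apply/asboolP; exists 1, i, j; rewrite tofrac1 mul1r.
Qed.

Lemma R3den_val i j :
  R3poly (den i j) = (R3t + l1%:~R) ^+ i * (R3t + l2%:~R) ^+ j.
Proof.
rewrite rmorphM !rmorphXn !rmorphD /=.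
by rewrite -[l1 in LHS]intz -[l2 in LHS]intz !rmorph_int.
Qed.

Lemma R3t1_unit : R3t + l1%:~R \is a GRing.unit.
Proof. by have := R3den_unit 1 0; rewrite R3den_val expr1 expr0 mulr1. Qed.
Lemma R3t2_unit : R3t + l2%:~R \is a GRing.unit.
Proof. by have := R3den_unit 0 1; rewrite R3den_val expr1 expr0 mul1r. Qed.

Lemma R3E (x : R3) : exists pij : {poly int} * nat * nat,
  x * R3poly (den pij.1.2 pij.2) == R3poly pij.1.1.
Proof.
have /asboolP[p [i [j xE]]] := R3valP x; exists (p, i, j); apply/eqP/val_inj.
by rewrite -[LHS]/(R3val (_ * _)) R3valM /= xE mulfVK // R3den_neq0.
Qed.

(* (t + l1)^v1 (t + l2)^v2 *)
Definition mon (v : 'cV[int]_2) : R3 :=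
  (R3t + l1%:~R) ^ v 0 0 * (R3t + l2%:~R) ^ v 1 0.

Lemma mon_unit v : mon v \is a GRing.unit.
Proof. by rewrite unitrM !unitrXz ?R3t1_unit ?R3t2_unit. Qed.
Lemma monD v w : mon (v + w) = mon v * mon w.
Proof.
by rewrite /mon !mxE !exprzDr ?R3t1_unit ?R3t2_unit // mulrACA.
Qed.
Lemma mon0 : mon 0 = 1.
Proof. by rewrite /mon !mxE !expr0z mulr1. Qed.

(* Evaluation at u: the extension to the localization of Z[t] -> A, t |-> u. *)
Section Extension.
Variables (A : comUnitRingType) (u : A).
Hypothesis u1 : u + l1%:~R \is a GRing.unit.
Hypothesis u2 : u + l2%:~R \is a GRing.unit.

Local Notation ev p := (map_poly intr p).[u].

Definition R3eval (x : R3) : A :=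
  let pij := xchoose (R3E x) in ev pij.1.1 / ev (den pij.1.2 pij.2).

Lemma ev_den_unit i j : ev (den i j) \is a GRing.unit.
Proof.
rewrite /R3den rmorphM !rmorphXn !rmorphD /= map_polyX !map_polyC /= !hornerE.
by rewrite unitrM !unitrX.
Qed.

Lemma evD p q : ev (p + q) = ev p + ev q.
Proof. by rewrite rmorphD hornerD. Qed.
Lemma evB p q : ev (p - q) = ev p - ev q.
Proof. by rewrite rmorphB hornerD hornerN. Qed.
Lemma evM p q : ev (p * q) = ev p * ev q.
Proof. by rewrite rmorphM hornerM. Qed.

Lemma R3poly_inj : injective R3poly.
Proof. by move=> p q /(congr1 R3val)/= /eqP; rewrite tofrac_eq => /eqP. Qed.

Lemma R3evalE x p i j : x * R3poly (den i j) = R3poly p ->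
  R3eval x = ev p / ev (den i j).
Proof.
move=> xE; rewrite /R3eval; have /eqP := xchooseP (R3E x).
move: (xchoose _) => [[q k] l] /= xE'.
have pq : q * den i j = p * den k l.
  by apply: R3poly_inj; rewrite (rmorphM _ q) (rmorphM _ p) /= -xE -xE' mulrAC.
apply: (mulIr (ev_den_unit k l)); rewrite mulrVK ?ev_den_unit //.
apply: (mulIr (ev_den_unit i j)); rewrite -evM pq evM.
by rewrite mulrAC mulrVK ?ev_den_unit.
Qed.

Lemma R3rep x : exists p i j, x * R3poly (den i j) = R3poly p.
Proof. by case: (R3E x) => -[[p i] j] /eqP xE; exists p, i, j. Qed.

Fact R3eval_is_zmod_morphism : zmod_morphism R3eval.
Proof.
move=> x y; have [p [i [j xE]]] := R3rep x; have [q [k [l yE]]] := R3rep y.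
rewrite (R3evalE xE) (R3evalE yE).
rewrite (@R3evalE _ (p * den k l - q * den i j) (i + k) (j + l)); last first.
  rewrite -R3denM rmorphB (rmorphM _ p) (rmorphM _ q) (rmorphM _ (den i j)) /=.
  by rewrite -xE -yE mulrBl mulrA [y * _ * _]mulrAC mulrA.
rewrite -R3denM evB (evM p) (evM q) (evM (den i j)); apply: (mulIr (ev_den_unit i j)).
apply: (mulIr (ev_den_unit k l)).
rewrite -mulrA mulrVK ?unitrM ?ev_den_unit // !mulrBl mulrVK ?ev_den_unit //.
by rewrite (mulrAC (ev q / _)) mulrVK ?ev_den_unit // mulrAC.
Qed.
Fact R3eval_is_monoid_morphism : monoid_morphism R3eval.
Proof.
split=> [|x y].
  rewrite (@R3evalE _ 1 0 0); first by rewrite /R3den !expr0 mulr1 divrr // rmorph1 hornerC unitr1.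
  by rewrite /R3den !expr0 mulr1 mul1r.
have [p [i [j xE]]] := R3rep x; have [q [k [l yE]]] := R3rep y.
rewrite (R3evalE xE) (R3evalE yE).
rewrite (@R3evalE _ (p * q) (i + k) (j + l)); last first.
  by rewrite -R3denM (rmorphM _ p) (rmorphM _ (den i j)) /= -xE -yE mulrACA.
by rewrite -R3denM (evM p) (evM (den i j)) invrM ?ev_den_unit // [_^-1 * _^-1]mulrC mulrACA.
Qed.

Lemma R3eval_t : R3eval R3t = u.
Proof.
rewrite (@R3evalE _ 'X 0 0); last by rewrite /R3den !expr0 mulr1 rmorph1 mulr1.
by rewrite map_polyX hornerX /R3den !expr0 mulr1 rmorph1 hornerC divr1.
Qed.

Lemma R3_extension : exists f : {rmorphism R3 -> A}, f R3t = u.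
Proof.
pose f := HB.pack_for {rmorphism R3 -> A} R3eval
  (GRing.isZmodMorphism.Build _ _ R3eval R3eval_is_zmod_morphism)
  (GRing.isMonoidMorphism.Build _ _ R3eval R3eval_is_monoid_morphism).
by exists f; exact: R3eval_t.
Qed.

End Extension.

Lemma R3_rmorph_uniq (A : comUnitRingType) (f g : {rmorphism R3 -> A}) :
  f R3t = g R3t -> f =1 g.
Proof.
move=> fg.
have fgp p : f (R3poly p) = g (R3poly p).
  by rewrite R3poly_horner -!horner_map -!map_poly_comp fg;
     congr _.[_]; apply: eq_map_poly => z /=; rewrite !rmorph_int.
move=> x; have [p [i [j xE]]] := R3rep x.
apply: (mulIr (rmorph_unit f (R3den_unit i j))).
by rewrite -rmorphM xE !fgp -xE rmorphM.
Qed.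

End R3.

(* P^v is P * mon v. The additive group of derivations is a groupType, so its
   sum is written multiplicatively. *)
Section Derivations.
Variables l1 l2 : int.

Record der : Type := Der {
  der_fun :> 'cV[int]_2 -> R3 l1 l2;
  _ : `[< forall v w, der_fun (v + w) = der_fun v + der_fun w * mon l1 l2 v >] }.
HB.instance Definition _ := [isSub for der_fun].
HB.instance Definition _ := [Choice of der by <:].

Lemma derP (d e : der) : (forall v, d v = e v) -> d = e.
Proof. by move=> de; apply/val_inj/funext. Qed.
Lemma derD (d : der) v w : d (v + w) = d v + d w * mon l1 l2 v.
Proof. by case: d => d /= /asboolP. Qed.

Lemma der_zero_subproof :
  `[< forall v w : 'cV[int]_2, 0 = 0 + 0 * mon l1 l2 v :> R3 l1 l2 >].
Proof. by apply/asboolP => v w; rewrite mul0r addr0. Qed.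
Definition der_zero : der := @Der (fun=> 0) der_zero_subproof.

Lemma der_add_subproof (d e : der) :
  `[< forall v w, d (v + w) + e (v + w) = d v + e v + (d w + e w) * mon l1 l2 v >].
Proof. by apply/asboolP => v w; rewrite !derD mulrDl addrACA. Qed.
Definition der_add (d e : der) : der :=
  @Der (fun v => d v + e v) (der_add_subproof d e).

Lemma der_opp_subproof (d : der) :
  `[< forall v w, - d (v + w) = - d v + - d w * mon l1 l2 v >].
Proof. by apply/asboolP => v w; rewrite derD opprD mulNr. Qed.
Definition der_opp (d : der) : der := @Der (fun v => - d v) (der_opp_subproof d).

Lemma der_addA : associative der_add.
Proof. by move=> d e f; apply: derP => v /=; rewrite addrA. Qed.
Lemma der_add0 : left_id der_zero der_add.
Proof. by move=> d; apply: derP => v /=; rewrite add0r. Qed.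
Lemma der_addr0 : right_id der_zero der_add.
Proof. by move=> d; apply: derP => v /=; rewrite addr0. Qed.
Lemma der_addN : left_inverse der_zero der_opp der_add.
Proof. by move=> d; apply: derP => v /=; rewrite addNr. Qed.
Lemma der_addrN : right_inverse der_zero der_opp der_add.
Proof. by move=> d; apply: derP => v /=; rewrite addrN. Qed.

HB.instance Definition _ := isGroup.Build der
  der_addA der_add0 der_addr0 der_addN der_addrN.

End Derivations.

Definition mx2 (a b c d : int) : 'M[int]_2 :=
  \matrix_(i, j) (if i == 0 then if j == 0 then a else b
                  else if j == 0 then c else d).

(* Only used for l2 = 1 and l2 = -1. *)
Definition Kmx (l2 : int) : 'M[int]_2 :=
  if l2 == 1 then mx2 (- 1) (- 1) 0 1 else mx2 1 0 (- 1) (- 1).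

Section GroupK.
Variable l2 : int.

(* beta in K acts on Z^2 by v |-> Kval beta *m v. *)
Record Kgrp : Type := MkK {
  Kval : 'M[int]_2; _ : Kval \in [:: 1%:M; Kmx l2] }.
HB.instance Definition _ := [isSub for Kval].
HB.instance Definition _ := [Choice of Kgrp by <:].

Lemma KvalP (b : Kgrp) : Kval b = 1%:M \/ Kval b = Kmx l2.
Proof. by case: b => b /=; rewrite !inE => /orP[]/eqP->; [left|right]. Qed.

Lemma KmxK : Kmx l2 *m Kmx l2 = 1%:M.
Proof.
rewrite /Kmx; case: ifP => _; apply/matrixP => i j.
  by rewrite !mxE !big_ord_recl big_ord0 !mxE;
     case: i => [[|[|//]] ?]; case: j => [[|[|//]] ?].
by rewrite !mxE !big_ord_recl big_ord0 !mxE;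
   case: i => [[|[|//]] ?]; case: j => [[|[|//]] ?].
Qed.

Lemma Kmul_subproof (b c : Kgrp) : Kval b *m Kval c \in [:: 1%:M; Kmx l2].
Proof.
by case: (KvalP b) (KvalP c) => -> [] ->;
   rewrite ?mul1mx ?mulmx1 ?KmxK !inE eqxx ?orbT.
Qed.
Lemma Kone_subproof : (1%:M : 'M[int]_2) \in [:: 1%:M; Kmx l2].
Proof. by rewrite inE eqxx. Qed.
Definition Kone := MkK Kone_subproof.
Definition Kmul b c := MkK (Kmul_subproof b c).

Lemma KmulA : associative Kmul.
Proof. by move=> b c d; apply: val_inj; rewrite /= mulmxA. Qed.
Lemma Kmul1 : left_id Kone Kmul.
Proof. by move=> b; apply: val_inj; rewrite /= mul1mx. Qed.
Lemma Kmulr1 : right_id Kone Kmul.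
Proof. by move=> b; apply: val_inj; rewrite /= mulmx1. Qed.
(* Both elements of K are involutions. *)
Lemma KmulV : left_inverse Kone id Kmul.
Proof.
by move=> b; apply: val_inj => /=; case: (KvalP b) => ->; rewrite ?mul1mx ?KmxK.
Qed.

HB.instance Definition _ := isGroup.Build Kgrp KmulA Kmul1 Kmulr1 KmulV KmulV.

End GroupK.

Section Actions.
Variable l2 : int.
Hypothesis hl2 : l2 = 1 \/ l2 = - 1.
Local Notation R := (R3 0 l2).
Local Notation t := (R3t 0 l2).
Local Notation mon := (mon 0 l2).
Local Notation K := (Kgrp l2).

Lemma monXz v n : mon v ^ n = mon (n *: v).
Proof.
rewrite /mon !mxE exprMz_comm ?unitrXz ?R3t1_unit ?R3t2_unit //; last exact: mulrC.
rewrite !exprz_exp.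
by rewrite !(mulrC n).
Qed.

Lemma mon_e1 : mon (delta_mx 0 0) = t.
Proof. by rewrite /mon !mxE /= expr1z expr0z mulr1 addr0. Qed.
Lemma mon_e2 : mon (delta_mx 1 0) = t + l2%:~R.
Proof. by rewrite /mon !mxE /= expr1z expr0z mul1r. Qed.

Lemma colE2 (v : 'cV[int]_2) :
  v = v 0 0 *: delta_mx 0 0 + v 1 0 *: delta_mx 1 0.
Proof.
apply/matrixP => i j; rewrite !mxE (ord1 j).
by case: i => [[|[|//]] ?] /=; rewrite ?mulr1 ?mulr0 ?addr0 ?add0r;
   congr (v _ _); apply: val_inj.
Qed.

Lemma Kmx_e (b : K) :
  mon (Kval b *m delta_mx 1 0) = mon (Kval b *m delta_mx 0 0) + l2%:~R.
Proof.
case: (KvalP b) => ->; first by rewrite !mul1mx mon_e1 mon_e2.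
rewrite -!colE /mon /Kmx.
case: hl2 => -> /=; rewrite !mxE /= ?expr0z ?expr1z ?addr0 ?mulr1 ?mul1r.
  have U : R3t 0 1 \is a GRing.unit by have := R3t1_unit 0 1; rewrite addr0.
  by rewrite exprN1 mulrDr mulVr // mulr1 addrC.
have U := R3t2_unit 0 (- 1).
apply: (mulIr U); rewrite exprN1 mulrDl mulrVK // mulVr // rmorphN1 mulN1r.
by rewrite opprD opprK addrA subrr add0r.
Qed.

Lemma ract_ex (b : K) :
  exists f : {rmorphism R -> R}, forall v, f (mon v) = mon (Kval b *m v).
Proof.
have [||f ft] := @R3_extension 0 l2 R (mon (Kval b *m delta_mx 0 0)).
- by rewrite addr0 mon_unit.
- by rewrite -Kmx_e mon_unit.
have fl : f (t + l2%:~R) = mon (Kval b *m delta_mx 1 0).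
  by rewrite rmorphD rmorph_int ft Kmx_e.
exists f => v; rewrite {2}[v]colE2 mulmxDr -!scalemxAr monD -!monXz -fl -ft.
by rewrite /mon rmorphM !rmorphXz ?R3t1_unit ?R3t2_unit ?addr0.
Qed.

(* The ring automorphism S |-> S^beta; see ract_uniq and ract_bij. *)
Definition ract (b : K) : {rmorphism R -> R} := projT1 (cid (ract_ex b)).

Lemma ract_mon b v : ract b (mon v) = mon (Kval b *m v).
Proof. by rewrite /ract; case: cid => f. Qed.

Lemma ract_uniq (b : K) (f : {rmorphism R -> R}) :
  (forall v, f (mon v) = mon (Kval b *m v)) -> ract b =1 f.
Proof. by move=> fP; apply: R3_rmorph_uniq; rewrite -mon_e1 ract_mon fP. Qed.

Lemma ract1 S : ract 1%g S = S.
Proof. by apply: (@ract_uniq _ idfun) => v; rewrite mul1mx. Qed.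
Lemma ractM (b c : K) S : ract (b * c)%g S = ract b (ract c S).
Proof.
apply: (@ract_uniq _ (ract b \o ract c)) => v /=.
by rewrite !ract_mon mulmxA.
Qed.

Lemma ract_bij (b : K) : bijective (ract b).
Proof.
by exists (ract (b^-1)%g) => S; rewrite -ractM ?mulVg ?mulgV ract1.
Qed.

Definition K_act (b : K) (S : unitg R) : unitg R :=
  Unitg (rmorph_unit (ract b) (unitgP S)).

Lemma K_act1 S : K_act 1%g S = S.
Proof. by apply: val_inj; rewrite /= ract1. Qed.
Lemma K_actM b c S : K_act (b * c)%g S = K_act b (K_act c S).
Proof. by apply: val_inj; rewrite /= ractM. Qed.
Lemma K_actMr b S T : K_act b (S * T)%g = (K_act b S * K_act b T)%g.
Proof. by apply: val_inj; rewrite /= rmorphM. Qed.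
Definition K_action : group_action K (unitg R) :=
  GroupAction K_act1 K_actM K_actMr.

Definition UK : groupType := sdprod K_action.

Definition alpha (x : UK) (S : R) : R := unitg_val x.1 * ract x.2 S.

Lemma der_act_subproof (x : UK) (d : der 0 l2) :
  let e v := alpha x (d (Kval (x.2^-1)%g *m v)) in
  `[< forall v w, e (v + w) = e v + e w * mon v >].
Proof.
apply/asboolP => v w; rewrite /alpha mulmxDr derD rmorphD mulrDr rmorphM ract_mon.
by rewrite mulmxA -[Kval _ *m Kval _]/(Kval (_ * _)%g) mulgV mul1mx mulrA.
Qed.
(* delta |-> alpha o delta o beta^-1 *)
Definition der_act (x : UK) (d : der 0 l2) : der 0 l2 := Der (der_act_subproof x d).

Lemma der_act1 d : der_act 1%g d = d.
Proof. apply: derP => v; rewrite -[LHS]/(1 * ract 1%g (d (Kval (1^-1)%g *m v))).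
by rewrite mul1r ract1 invg1 mul1mx. Qed.
Lemma der_actM x y d : der_act (x * y)%g d = der_act x (der_act y d).
Proof.
apply: derP => v.
have E : Kval ((x.2 * y.2)^-1)%g *m v = Kval (y.2^-1)%g *m (Kval (x.2^-1)%g *m v).
  by rewrite invgM -[Kval (_ * _)%g]/(Kval _ *m Kval _) -mulmxA.
rewrite -[LHS]/(unitg_val x.1 * ract x.2 (unitg_val y.1) *
  ract (x.2 * y.2)%g (d (Kval ((x.2 * y.2)^-1)%g *m v))).
by rewrite E ractM /= /alpha rmorphM mulrA.
Qed.
Lemma der_actMr x d e : der_act x (d * e)%g = (der_act x d * der_act x e)%g.
Proof. by apply: derP => v; rewrite /= /alpha rmorphD mulrDr. Qed.
Definition der_action : group_action UK (der 0 l2) :=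
  GroupAction der_act1 der_actM der_actMr.

End Actions.

(* Main.v *)
Require Import Defs.
From HB Require Import structures.
From mathcomp Require Import all_boot all_order all_algebra.
From mathcomp Require Import monoid boolp zify.

(** Write R for the localization, and let [aff] be the group of the maps
    [x |-> r + x * mon v] of R, that is, the semidirect product of the additive
    group of R by Z^2. The proof identifies BMG with [aff], and then computes the
    automorphisms of [aff].

    BMG is [aff] ([bmg_aff_isomorphic]). The generators [a], [s], [t] are sent to
    the translation by 1 and to the two basis vectors of Z^2, ordered so that
    [1 + mon dir_s = mon dir_t]; this is a surjective morphism [bmg_aff]. For
    injectivity, the relations imply that all conjugates of [a] by powers of [s]
    commute ([commute_iter_conj]), so that they generate a Z[X]-module in which
    [X] is the conjugation by [s]; there [t] acts as [X + 1]
    ([poly_powerX1]). It follows that each element of BMG is a fraction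
    with denominator [X^i (X+1)^j] followed by an element [s^k t^l]
    ([bmg_normal_form]). The image of such an element is trivial only if the
    numerator, [k] and [l] vanish.

    Automorphisms of [aff] ([aut_aff]). A derivation [d] gives the automorphism
    [(r, v) |-> (r + d v, v)], and [(U, b)] with [U] a unit and [b] in K gives
    [(r, v) |-> (U * r^b, b v)]; conjugating the former by the latter is the
    action on derivations, so these automorphisms compose as in the semidirect
    product. There are no others ([der_autg_surj]): R consists of the commutators
    of [aff] ([translation_commutator]), hence is characteristic; an
    automorphism restricted to R is, up to a unit, a ring endomorphism that
    permutes the monomials through a matrix B; and the equality
    [mon (B e1) + l2 = mon (B e2)] in R leaves for B just the two matrices of K
    ([mon_exponents]). *)

Set Implicit Arguments.
Unset Strict Implicit.
Unset Printing Implicit Defensive.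

Import GRing.Theory Num.Theory.

Local Open Scope ring_scope.

(** * Isomorphic groups have isomorphic automorphism groups *)

Section Isomorphisms.
Local Open Scope group_scope.

Lemma isomorphic_groupsI (G H : groupType) (f : G -> H) :
  {morph f : x y / x * y} -> bijective f -> isomorphic_groups G H.
Proof.
move=> fM f_bij.
pose F := HB.pack_for {multiplicative G -> H} f (isMultiplicative.Build _ _ f fM).
by exists F.
Qed.

Lemma isomorphic_groups_inj_surj (G H : groupType) (f : G -> H) :
  {morph f : x y / x * y} -> injective f -> (forall y, exists x, f x = y) ->
  isomorphic_groups G H.
Proof.
move=> fM f_inj f_surj; apply: (isomorphic_groupsI fM).
pose h y := projT1 (cid (f_surj y)).
have hK : cancel h f by move=> y; rewrite /h; case: cid.
by exists h => // x; apply: f_inj; rewrite hK.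
Qed.

Lemma isomorphic_groups_sym (G H : groupType) :
  isomorphic_groups G H -> isomorphic_groups H G.
Proof.
case=> f [g fK gK]; apply: (@isomorphic_groupsI _ _ g); last by exists f.
by move=> x y; apply: (can_inj fK); rewrite gmulfM !gK.
Qed.

Lemma isomorphic_groups_trans (H G K : groupType) :
  isomorphic_groups G H -> isomorphic_groups H K -> isomorphic_groups G K.
Proof.
case=> f f_bij [g g_bij]; apply: (@isomorphic_groupsI _ _ (g \o f)).
  by move=> x y; rewrite /= !gmulfM.
exact: bij_comp.
Qed.

Lemma autg_isomorphic (G H : groupType) :
  isomorphic_groups G H -> isomorphic_groups (autg G) (autg H).
Proof.
case=> f [g fK gK].
have gM : {morph g : x y / x * y}.
  by move=> x y; apply: (can_inj fK); rewrite gmulfM !gK.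
have fP (u : autg G) :
    `[< bijective (f \o u \o g) /\ {morph f \o u \o g : x y / x * y} >].
  apply/asboolP; split; last by move=> x y /=; rewrite gM autgM gmulfM.
  apply: bij_comp; last by exists f.
  by apply: bij_comp; [exists g | exact: autg_bij].
have gP (u : autg H) :
    `[< bijective (g \o u \o f) /\ {morph g \o u \o f : x y / x * y} >].
  apply/asboolP; split; last by move=> x y /=; rewrite gmulfM autgM gM.
  apply: bij_comp; last by exists g.
  by apply: bij_comp; [exists f | exact: autg_bij].
apply: (@isomorphic_groupsI _ _ (fun u => Autg (fP u))).
  by move=> u v; apply: autgP => x /=; rewrite fK.
exists (fun u => Autg (gP u)) => u; apply: autgP => x /=.
  by rewrite !fK.
by rewrite !gK.
Qed.

End Isomorphisms.

(** * Integer powers in a group *)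

Section IntegerPowers.
Local Open Scope group_scope.
Variable G : groupType.
Implicit Types (x y : G) (m n : int).

Definition zpow x n : G :=
  match n with Posz k => x ^+ k | Negz k => x ^- k.+1 end.

Lemma zpow0 x : zpow x 0 = 1. Proof. by []. Qed.
Lemma zpowN1 x : zpow x (- 1)%R = x^-1. Proof. by []. Qed.

Lemma zpowS x n : zpow x (n + 1)%R = zpow x n * x.
Proof.
case: n => [k|k]; first by rewrite (_ : Posz k + 1 = Posz k.+1)%R /= ?expgSr //; lia.
have -> : (Negz k + 1 = - k%:Z)%R by rewrite NegzE; lia.
rewrite /= -[in RHS]expVgn expgSr mulgVK expVgn.
by case: k => [|k] //=; rewrite invg1.
Qed.

Lemma zpowB1 x n : zpow x (n - 1)%R = zpow x n * x^-1.
Proof. by rewrite -[X in _ = zpow x X * _](subrK (1 : int)) zpowS mulgK. Qed.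

Lemma zpowD x m n : zpow x (m + n)%R = zpow x m * zpow x n.
Proof.
elim: n => [|n IHn|n IHn]; first by rewrite addr0 mulg1.
  by rewrite -addn1 PoszD addrA !zpowS IHn mulgA.
have -> : (- n.+1%:Z = - n%:Z - 1)%R by lia.
by rewrite addrA !zpowB1 IHn mulgA.
Qed.

Lemma zpowSl x n : zpow x (n + 1)%R = x * zpow x n.
Proof. by rewrite addrC zpowD. Qed.

Lemma commute_zpow x y n : commute x y -> commute x (zpow y n).
Proof.
by case: n => k xy /=; [exact: commuteX | apply/commuteV/commuteX].
Qed.

Lemma commute_zpow2 x y m n : commute x y -> commute (zpow x m) (zpow y n).
Proof. by move=> xy; do 2 apply/commute_zpow/commute_sym. Qed.

Lemma zpowM x y n : commute x y -> zpow (x * y) n = zpow x n * zpow y n.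
Proof.
move=> xy; case: n => k /=; first exact: expgMn.
by rewrite expgMn // invgM; apply/commute_sym/commuteV/commute_sym/commuteV/commuteX2.
Qed.

End IntegerPowers.

Lemma zpow_morph (G H : groupType) (f : G -> H) x n :
  {morph f : x y / (x * y)%g} -> f (zpow x n) = zpow (f x) n.
Proof.
move=> fM.
have f1 : f 1%g = 1%g by apply: (mulgI (f 1%g)); rewrite -fM !mulg1.
have fV y : f y^-1%g = (f y)^-1%g.
  by apply: (mulIg (f y)); rewrite -fM !mulVg.
have fX y k : f (y ^+ k)%g = (f y ^+ k)%g.
  by elim: k => [|k IHk] //; rewrite !expgS fM IHk.
by case: n => k /=; rewrite ?fV fX.
Qed.

(** * Universal property of a presented group *)

Section PresentationUniversal.
Local Open Scope group_scope.
Variables (I : choiceType) (rels : seq (word I * word I)) (G : groupType).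
Variable gen : I -> G.

Definition eval_letter (x : I * bool) : G :=
  if x.2 then (gen x.1)^-1 else gen x.1.
Definition eval_word (w : word I) : G :=
  foldr (fun x g => eval_letter x * g) 1 w.

Lemma eval_word_cat u v : eval_word (u ++ v) = eval_word u * eval_word v.
Proof. by elim: u => [|x u IHu] /=; rewrite ?mul1g // IHu mulgA. Qed.

Lemma eval_inv_letter x : eval_letter (inv_letter x) = (eval_letter x)^-1.
Proof. by case: x => i [] //=; rewrite /eval_letter /= invgK. Qed.

Lemma eval_inv_word w : eval_word (inv_word w) = (eval_word w)^-1.
Proof.
elim: w => [|x w IHw]; first by rewrite invg1.
rewrite /inv_word map_cons rev_cons -cats1 eval_word_cat IHw /= mulg1.
by rewrite eval_inv_letter invgM.
Qed.

Hypothesis genP : forall r, r \in rels -> eval_word r.1 = eval_word r.2.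

Lemma eval_pres_eq u v : pres_eq rels u v -> eval_word u = eval_word v.
Proof.
elim=> {u v} [r /genP //|x|u //|u v _ -> //|u v w _ -> _ -> //|].
  by rewrite /= eval_inv_letter mulg1 mulgV.
by move=> u u' v v' _ uu' _ vv'; rewrite !eval_word_cat uu' vv'.
Qed.

Definition pres_lift (x : presented rels) : G := eval_word (repr x).

Lemma pres_liftE w : pres_lift (\pi_(presented rels)%qT w) = eval_word w.
Proof. exact/eval_pres_eq/pres_repr. Qed.

Lemma pres_liftM : {morph pres_lift : x y / x * y}.
Proof.
elim/quotW=> u; elim/quotW=> v; rewrite [_ * _]presented_mulE !pres_liftE.
exact: eval_word_cat.
Qed.

End PresentationUniversal.

(** * Normal forms from the relations of Baumslag's group *)

Section BaumslagRelations.
Local Open Scope group_scope.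
Variables (G : groupType) (a s t : G).
Hypotheses (st : commute s t) (a_at : commute a (a ^ t^-1)).
Hypothesis a_as : a * a ^ s^-1 = a ^ t^-1.

Lemma commute_conj (x y g : G) : commute x y -> commute (x ^ g) (y ^ g).
Proof. by rewrite /commute -!conjMg => ->. Qed.

(** The relations give only that [a] commutes with [a_1], where [a_k] is
    [s^k a s^-k]. Conjugation by [t] sends [a_k] to [a_k a_(k+1)], so a
    commutation of [a] with [a_(n+1)] becomes one of [a a_1] with
    [a_(n+1) a_(n+2)], from which the commutations already known, shifted by
    powers of [s], isolate that of [a] with [a_(n+2)]. *)
Lemma commute_iter_conj n : commute a (a ^ s^-1 ^+ n).
Proof.
have shift k n' : commute a (a ^ s^-1 ^+ n') ->
    commute (a ^ s^-1 ^+ k) (a ^ s^-1 ^+ (k + n')%N).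
  by move/(commute_conj (s^-1 ^+ k)); rewrite -conjgM -expgnDr addnC.
have a1 : commute a (a ^ s^-1 ^+ 1).
  apply: (mulgI a); rewrite expg1 [a * (_ * a)]mulgA a_as.
  exact: a_at.
have: commute a (a ^ s^-1 ^+ n) /\ commute a (a ^ s^-1 ^+ n.+1).
  elim: n => [|n [an an1]]; first by split; [rewrite expg0 conjg1 |].
  split=> //.
  have a_t k : (a ^ s^-1 ^+ k) ^ t^-1 = a ^ s^-1 ^+ k * a ^ s^-1 ^+ k.+1.
    rewrite -conjgM -(commuteX k (commuteV (commute_sym (commuteV st)))) conjgM.
    by rewrite -a_as conjMg -conjgM -expgS.
  have := commute_conj t^-1 an1; rewrite a_t -a_as.
  rewrite -[in a ^ s^-1](expg1 s^-1) => a1an.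
  have aan2 : commute (a * a ^ s^-1 ^+ 1) (a ^ s^-1 ^+ n.+2).
    have {}a1an : commute (a ^ s^-1 ^+ n.+1 * a ^ s^-1 ^+ n.+2)
                          (a * a ^ s^-1 ^+ 1) by exact: commute_sym.
    have a1n : commute (a ^ s^-1 ^+ n.+1) (a * a ^ s^-1 ^+ 1).
      apply: commuteM; apply: commute_sym => //.
      by have := shift 1%N n an; rewrite add1n.
    apply/commute_sym; rewrite -[a ^ s^-1 ^+ n.+2](mulKg (a ^ s^-1 ^+ n.+1)).
    apply/commute_sym/commuteM; last exact: commute_sym.
    exact/commuteV/commute_sym.
  rewrite -[a in commute a _](mulgK (a ^ s^-1 ^+ 1)).
  apply/commute_sym/commuteM; first exact: commute_sym.
  by apply/commuteV/commute_sym; by have := shift 1%N n.+1 an1; rewrite add1n.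
by case.
Qed.

(** This is [p] applied to [a] in the Z[X]-module generated by [a], where [X]
    acts by conjugation by [s]: the product over [i] of [(s^i a s^-i)^p_i].
    The Horner recursion on the coefficients gives a meaning to it before the
    factors are known to commute. *)
Definition poly_power (p : {poly int}) : G :=
  foldr (fun c g => zpow a c * g ^ s^-1) 1 p.

Lemma poly_power0 : poly_power 0 = 1.
Proof. by rewrite /poly_power polyseq0. Qed.

Lemma poly_powerXaddC p c :
  poly_power (p * 'X + c%:P)%R = zpow a c * poly_power p ^ s^-1.
Proof.
rewrite -cons_poly_def /poly_power polyseq_cons; case: ifP => //= /negbFE.
rewrite nil_poly => /eqP ->; rewrite polyseq0 polyseqC /= conj1g mulg1.
by case: eqP => [->|_] /=; rewrite ?conj1g ?mulg1.
Qed.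

Lemma poly_powerC c : poly_power c%:P = zpow a c.
Proof.
by rewrite -[c%:P]add0r -(mul0r 'X) poly_powerXaddC poly_power0 conj1g mulg1.
Qed.

Lemma poly_powerX p : poly_power p ^ s^-1 = poly_power (p * 'X)%R.
Proof. by rewrite -[(p * 'X)%R]addr0 poly_powerXaddC mul1g. Qed.

Lemma zpow_conjg x g c : zpow x c ^ g = zpow (x ^ g) c :> G.
Proof. by case: c => c /=; rewrite ?conjVg conjXg. Qed.

Lemma commute_poly_power p n : commute a (poly_power p ^ s^-1 ^+ n).
Proof.
elim/poly_ind: p n => [|p c IHp] n.
  by rewrite poly_power0 conj1g; exact: commute1.
rewrite poly_powerXaddC conjMg -conjgM -expgS zpow_conjg.
by apply: commuteM => //; apply/commute_zpow/commute_iter_conj.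
Qed.

Lemma poly_powerD p q : poly_power (p + q)%R = poly_power p * poly_power q.
Proof.
elim/poly_ind: p q => [|p c IHp] q; first by rewrite add0r poly_power0 mul1g.
elim/poly_ind: q => [|q d _]; first by rewrite addr0 poly_power0 mulg1.
rewrite addrACA -mulrDl -polyCD !poly_powerXaddC zpowD IHp conjMg.
have dP : commute (zpow a d) (poly_power p ^ s^-1).
  by apply/commute_sym/commute_zpow/commute_sym/(commute_poly_power p 1).
move: (_ ^ _) (_ ^ _) dP => x y dx.
by rewrite -!mulgA (mulgA (zpow a d)) dx -!mulgA.
Qed.

(** The relation [a a^s = a^t] says that [t] acts on [a] as [X + 1]; as [s] and
    [t] commute, it acts so on the whole module generated by [a]. *)
Lemma poly_powerX1 p : poly_power p ^ t^-1 = poly_power (p * ('X + 1))%R.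
Proof.
rewrite mulrDr mulr1 poly_powerD -poly_powerX.
elim/poly_ind: p => [|p c IHp]; first by rewrite poly_power0 !conj1g mulg1.
rewrite poly_powerXaddC (conjMg (zpow _ _)) (conjMg (zpow _ _)) !zpow_conjg.
rewrite -a_as zpowM; last first.
  exact: (commute_iter_conj 1).
have -> : (poly_power p ^ s^-1) ^ t^-1 = (poly_power p ^ t^-1) ^ s^-1.
  by rewrite -!conjgM -!invgM st.
rewrite IHp (conjMg (poly_power p ^ _)).
have caP : commute (zpow a c) (zpow (a ^ s^-1) c * (poly_power p ^ s^-1) ^ s^-1).
  apply: commuteM; first exact/commute_zpow2/(commute_iter_conj 1).
  apply/commute_sym/commute_zpow/commute_sym.
  by rewrite -conjgM; exact: (commute_poly_power p 2).
move: (zpow a c) (zpow (a ^ s^-1) c) (poly_power p ^ s^-1)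
  ((poly_power p ^ s^-1) ^ s^-1) caP => x y u z xyz.
by rewrite !mulgA -(mulgA x) xyz.
Qed.

(** The polynomial part is conjugated by [(s^i t^j)^-1]; in the localization
    this is division by [X^i (X+1)^j], and so [p], [i], [j] encode a
    fraction and [k], [l] the component in Z^2. Fractions are not reduced, and
    so normal forms are not unique. *)
Definition normal_form (p : {poly int}) (i j : nat) (k l : int) : G :=
  poly_power p ^ (s ^+ i * t ^+ j) * zpow s k * zpow t l.

Lemma poly_power_iter p i j :
  poly_power p ^ (s ^+ i * t ^+ j)^-1 =
  poly_power (p * ('X + 1) ^+ j * 'X ^+ i)%R.
Proof.
rewrite invgM conjgM; have -> : poly_power p ^ t ^- j =
    poly_power (p * ('X + 1) ^+ j)%R.
  elim: j => [|j IHj]; first by rewrite expr0 mulr1 invg1 conjg1.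
  by rewrite expgS invgM conjgM IHj poly_powerX1 exprSr mulrA.
elim: i => [|i IHi]; first by rewrite expr0 mulr1 invg1 conjg1.
by rewrite expgS invgM conjgM IHi poly_powerX exprSr mulrA.
Qed.

(** Both fractions are brought to the common denominator [X^i (X+1)^j]. *)
Lemma mul_a_normal_form c p i j k l : exists q,
  zpow a c * normal_form p i j k l = normal_form q i j k l.
Proof.
exists (c%:P * ('X + 1) ^+ j * 'X ^+ i + p)%R; rewrite /normal_form.
rewrite poly_powerD -poly_power_iter poly_powerC.
by rewrite (conjMg (zpow a c ^ _)) conjgKV -!(mulgA (zpow a c)).
Qed.

Lemma conjgAC x g h : commute h g -> (x ^ g) ^ h^-1 = (x ^ h^-1) ^ g :> G.
Proof.
by move=> hg; rewrite -!conjgM; congr (_ ^ _); apply/commuteV/commute_sym/hg.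
Qed.

(** Left multiplication by a power of [s] or [t] conjugates the fraction and
    changes the component in Z^2: a generator multiplies the numerator, its
    inverse the denominator. *)
Lemma mul_s_normal_form p i j k l :
  s * normal_form p i j k l = normal_form (p * 'X)%R i j (k + 1)%R l.
Proof.
rewrite /normal_form zpowSl -poly_powerX -conjgAC ?conjgE ?invgK ?gnorm //.
by apply: commuteM; apply: commuteX.
Qed.

Lemma mul_sV_normal_form p i j k l :
  s^-1 * normal_form p i j k l = normal_form p i.+1 j (k - 1)%R l.
Proof.
have sg : commute s (s ^+ i * t ^+ j) by apply: commuteM; apply: commuteX.
rewrite /normal_form (addrC k) zpowD zpowN1 expgS -[s * _ * _]mulgA sg conjgM.
by rewrite [(_ ^ _) ^ s]conjgE; move: (_ ^ _) => y; rewrite !mulgA mulgK.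
Qed.

Lemma mul_t_normal_form p i j k l :
  t * normal_form p i j k l = normal_form (p * ('X + 1))%R i j k (l + 1)%R.
Proof.
have ts : commute t s := commute_sym st.
have sk : commute t (zpow s k) := commute_zpow k ts.
rewrite /normal_form zpowSl -poly_powerX1 -conjgAC; last first.
  by apply: commuteM; apply: commuteX.
move: (poly_power p ^ _) => y; rewrite conjgE invgK !mulgA; congr (_ * _).
by rewrite -!mulgA; do 2 congr (_ * _); rewrite -sk mulKg.
Qed.

Lemma mul_tV_normal_form p i j k l :
  t^-1 * normal_form p i j k l = normal_form p i j.+1 k (l - 1)%R.
Proof.
have ts : commute t s := commute_sym st.
have sk : commute (zpow s k) t := commute_sym (commute_zpow k ts).
rewrite /normal_form (addrC l) zpowD zpowN1 expgSr [s ^+ i * (_ * _)]mulgA.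
rewrite (conjgM _ _ t).
rewrite [(_ ^ _) ^ t]conjgE; move: (_ ^ _) => y; rewrite !mulgA; congr (_ * _).
by rewrite -!mulgA; do 2 congr (_ * _); rewrite mulgA -sk mulgK.
Qed.

End BaumslagRelations.

(** * The monomials span the localization additively *)

Section AdditiveSpan.
Variable l2 : int.
Local Notation R := (R3 0 l2).
Local Notation t := (R3t 0 l2).
Local Notation mon := (mon 0 l2).

Lemma monN v : mon (- v) * mon v = 1.
Proof. by rewrite -monD addNr mon0. Qed.

(** An induction principle: an additive statement about the localization needs
    to be checked on monomials only. A numerator is an integer combination of
    powers of [t], and dividing by a denominator multiplies by a monomial. *)
Lemma mon_span (P : R -> Prop) :
  (forall x y, P x -> P y -> P (x - y)) -> (forall v, P (mon v)) ->
  forall x, P x.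
Proof.
move=> PB Pmon.
have P0 : P 0 by rewrite -(subrr (mon 0)); apply: PB.
have PN x : P x -> P (- x) by move=> Px; rewrite -sub0r; apply: PB.
have PD x y : P x -> P y -> P (x + y).
  by move=> Px Py; rewrite -[y]opprK; apply/PB/PN.
have Pn x (n : nat) : P x -> P (x *+ n).
  by move=> Px; elim: n => [|n IHn]; rewrite ?mulr0n // mulrS; apply: PD.
have Pz x (n : int) : P x -> P (x *~ n).
  by case: n => n Px; [|apply: PN]; apply: Pn.
have Ppoly p v : P (R3poly 0 l2 p * mon v).
  elim/poly_ind: p v => [|p c IHp] v; first by rewrite rmorph0 mul0r.
  rewrite rmorphD rmorphM /= mulrDl -mulrA -[R3poly _ _ 'X]/t -mon_e1 -monD.
  apply: PD => //; rewrite R3poly_horner map_polyC hornerC mulrzl.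
  exact: Pz.
move=> x; have [p [i [j xE]]] := R3rep x.
pose v : 'cV[int]_2 := \col_k (if k == 0 then i%:Z else j%:Z).
have vE : R3poly 0 l2 (R3den 0 l2 i j) = mon v.
  by rewrite R3den_val /Defs.mon !mxE.
by rewrite -[x]mulr1 -(monN v) mulrCA mulrC -vE xE.
Qed.

End AdditiveSpan.

(** * The equation mon v + l2 = mon w *)

Section Exponents.

(** Dividing both sides by 2 reduces to the case where one of the three
    exponents is zero, which parity settles. *)
Lemma two_power_sum (k x y n : nat) : k = 1%N \/ k = 3%N ->
  (2 ^ x + 2 ^ n = k * 2 ^ y)%N ->
  [\/ [/\ k = 1, x = n & y = n.+1], [/\ k = 3, x = n.+1 & y = n]
    | [/\ k = 3, n = x.+1 & y = x]]%N.
Proof.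
move=> k13; elim: n x y => [|n IHn] [|x] [|y]; rewrite ?expnS ?expn0.
- by lia.
- case: y => [|y]; first by rewrite expn0 => ?; constructor 1; split; lia.
  by rewrite !expnS; lia.
- case: x => [|x]; first by rewrite expn0 => ?; constructor 2; split; lia.
  by rewrite expnS; have := expn_gt0 2 x; lia.
- by have := expn_gt0 2 x; lia.
- case: n IHn => [|n] _; first by rewrite expn0 => ?; constructor 3; split; lia.
  by rewrite expnS; have := expn_gt0 2 n; lia.
- by lia.
- by have := expn_gt0 2 n; have := expn_gt0 2 x; lia.
- move=> E; have /IHn : (2 ^ x + 2 ^ n = k * 2 ^ y)%N by lia.
  by case=> -[-> -> ->]; [constructor 1 | constructor 2 | constructor 3].
Qed.

Lemma two_powerz_sum (k : nat) (b d : int) : k = 1%N \/ k = 3%N ->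
  2 ^ b + 1 = k%:R * 2 ^ d :> rat ->
  [\/ [/\ k = 1%N, b = 0 & d = 1], [/\ k = 3%N, b = 1 & d = 0]
    | [/\ k = 3%N, b = - 1 & d = - 1]].
Proof.
(* multiplying by 2^n makes all the exponents nonnegative *)
move=> k13 E; pose n := (`|b| + `|d|)%N.
have [x xE] : exists x : nat, b + n%:Z = x%:Z by exists (absz (b + n%:Z)); lia.
have [y yE] : exists y : nat, d + n%:Z = y%:Z by exists (absz (d + n%:Z)); lia.
have U : (2 : rat) \is a GRing.unit by [].
have : (2 ^ x + 2 ^ n = k * 2 ^ y)%N.
  apply/eqP; rewrite -(eqr_nat rat) natrD natrM !natrX !exprnP -xE -yE.
  by rewrite !exprzDr // mulrA -E mulrDl mul1r.
case/(two_power_sum k13) => -[? ? ?];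
  [constructor 1 | constructor 2 | constructor 3]; split=> //; lia.
Qed.

Variable l2 : int.
Local Notation mon := (mon 0 l2).

Lemma mon_eval (u : rat) v w : u != 0 -> u + l2%:~R != 0 ->
  mon v + l2%:~R = mon w ->
  u ^ v 0 0 * (u + l2%:~R) ^ v 1 0 + l2%:~R =
  u ^ w 0 0 * (u + l2%:~R) ^ w 1 0.
Proof.
move=> u0 u1 vw.
have [||f ft] := @R3_extension 0 l2 rat u; rewrite ?addr0 ?unitfE //.
have fmon x : f (mon x) = u ^ x 0 0 * (u + l2%:~R) ^ x 1 0.
  rewrite /Defs.mon rmorphM !rmorphXz ?R3t1_unit ?R3t2_unit //.
  by rewrite !rmorphD !rmorph_int /= ft addr0.
by rewrite -!fmon -vw rmorphD rmorph_int.
Qed.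

Lemma mx2M (a b c d : int) :
  (mx2 a b c d *m delta_mx 0 0 = \col_i (if i == 0 then a else c)) *
  (mx2 a b c d *m delta_mx 1 0 = \col_i (if i == 0 then b else d)).
Proof.
by split; rewrite -colE; apply/matrixP => i j; rewrite !mxE.
Qed.

(** Although the equation takes place in a ring of rational functions, its
    values at two points suffice. The points are chosen so that the base of one
    of the two powers becomes 1, or its exponent is known from the first point:
    [t = 1, 2] for [l2 = 1] and [t = 2, 3] for [l2 = -1]. Each value is an equation between
    sums of powers of 2, possibly with a factor 3. The solutions are exactly
    the pairs of columns of the two matrices in K. *)
Lemma mon_exponents v w : l2 = 1 \/ l2 = - 1 -> mon v + l2%:~R = mon w ->
  exists2 b : Kgrp l2, Kval b *m delta_mx 0 0 = v & Kval b *m delta_mx 1 0 = w.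
Proof.
have colP (x : 'cV[int]_2) a c : x 0 0 = a -> x 1 0 = c ->
    \col_i (if i == 0 then a else c) = x.
  move=> <- <-; apply/matrixP => i j; rewrite mxE (ord1 j).
  by case: i => [[|[|//]] ?] /=; congr (x _ _); apply: val_inj.
have id2 : 1%:M = mx2 1 0 0 1.
  by apply/matrixP => -[[|[|//]] ?] [[|[|//]] ?]; rewrite !mxE.
have K1 : 1%:M \in [:: 1%:M; Kmx l2] by rewrite inE eqxx.
have K2 : Kmx l2 \in [:: 1%:M; Kmx l2] by rewrite !inE eqxx orbT.
case=> l2E vw.
  have [] := @two_powerz_sum 1 (v 1 0) (w 1 0); first by left.
  - have := mon_eval _ _ vw; rewrite l2E; move/(_ 1 isT isT).
    by rewrite !exp1rz !mul1r.
  - case=> _ v1 w1.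
    have [] := @two_powerz_sum 3 (v 0 0) (w 0 0); first by right.
    + have := mon_eval _ _ vw; rewrite l2E; move/(_ 2 isT isT).
      by rewrite v1 w1 expr0z mulr1 expr1z mulrC => ->.
    + by case.
    + by case=> _ v0 w0; exists (MkK K1); rewrite /= id2 mx2M; apply: colP.
    + by case=> _ v0 w0; exists (MkK K2); rewrite /= l2E /Kmx eqxx mx2M; apply: colP.
  - by case.
  - by case.
have [] := @two_powerz_sum 1 (w 0 0) (v 0 0); first by left.
- have := mon_eval _ _ vw; rewrite l2E; move/(_ 2 isT isT).
  by rewrite (_ : 2 + _ = 1) // !exp1rz !mulr1 mul1r => <-; rewrite subrK.
- case=> _ w0 v0.
  have [] := @two_powerz_sum 3 (w 1 0) (v 1 0); first by right.
  + have := mon_eval _ _ vw; rewrite l2E; move/(_ 3 isT isT).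
    by rewrite (_ : 3 + _ = 2) // v0 w0 expr0z expr1z mul1r => <-; rewrite subrK.
  + by case.
  + by case=> _ v1 w1; exists (MkK K1); rewrite /= id2 mx2M; apply: colP.
  + by case=> _ v1 w1; exists (MkK K2); rewrite /= l2E /Kmx /= mx2M; apply: colP.
- by case.
- by case.
Qed.

End Exponents.

(** * The affine group of the localization *)

Section AffineGroup.
Variable l2 : int.
Local Notation R := (R3 0 l2).
Local Notation mon := (mon 0 l2).

(** The pair [(r, v)] is the affine map [x |-> r + x * mon v] of the
    localization, which explains the product. *)
Definition aff : Type := (R * 'cV[int]_2)%type.
HB.instance Definition _ := Choice.copy aff (R * 'cV[int]_2)%type.

Definition aff_mul (x y : aff) : aff := (x.1 + y.1 * mon x.2, x.2 + y.2).
Definition aff_one : aff := (0, 0).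
Definition aff_inv (x : aff) : aff := (- x.1 * mon (- x.2), - x.2).

Lemma aff_mulA : associative aff_mul.
Proof.
move=> x y z; rewrite /aff_mul /= addrA; congr (_, _).
by rewrite mulrDl addrA -mulrA -monD (addrC x.2).
Qed.
Lemma aff_mul1 : left_id aff_one aff_mul.
Proof. by case=> r v; rewrite /aff_mul /= mon0 mulr1 !add0r. Qed.
Lemma aff_mulr1 : right_id aff_one aff_mul.
Proof. by case=> r v; rewrite /aff_mul /= mul0r !addr0. Qed.
Lemma aff_mulV : left_inverse aff_one aff_inv aff_mul.
Proof.
by case=> r v; rewrite /aff_mul /aff_inv /= -mulrDl !addNr mul0r.
Qed.
Lemma aff_mulVr : right_inverse aff_one aff_inv aff_mul.
Proof.
by case=> r v; rewrite /aff_mul /aff_inv /= -mulrA monN mulr1 !subrr.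
Qed.

HB.instance Definition _ := isGroup.Build aff
  aff_mulA aff_mul1 aff_mulr1 aff_mulV aff_mulVr.

Lemma affM (x y : aff) : (x * y)%g = (x.1 + y.1 * mon x.2, x.2 + y.2) :> aff.
Proof. by []. Qed.
Lemma affV (x : aff) : (x^-1)%g = (- x.1 * mon (- x.2), - x.2) :> aff.
Proof. by []. Qed.
Lemma aff1 : 1%g = (0, 0) :> aff. Proof. by []. Qed.

Lemma zpow_translation r n : zpow ((r, 0) : aff) n = (r *~ n, 0).
Proof.
elim: n => [|n IHn|n IHn] //.
  have -> : n.+1%:Z = n%:Z + 1 by lia.
  by rewrite zpowS IHn affM /= mon0 mulr1 addr0 mulrzDr.
have -> : - n.+1%:Z = - n%:Z - 1 by lia.
by rewrite zpowB1 IHn affM affV /= oppr0 mon0 !mulr1 addr0 mulrzBr.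
Qed.

Lemma zpow_linear v n : zpow ((0, v) : aff) n = (0, n *: v).
Proof.
elim: n => [|n IHn|n IHn]; first by rewrite zpow0 scale0r.
  have -> : n.+1%:Z = n%:Z + 1 by lia.
  by rewrite zpowS IHn affM /= mul0r addr0 scalerDl scale1r.
have -> : - n.+1%:Z = - n%:Z - 1 by lia.
by rewrite zpowB1 IHn affM affV /= oppr0 !mul0r addr0 scalerBl scale1r.
Qed.

End AffineGroup.

(** * Automorphisms of the affine group *)

Section AffineAutomorphisms.
Variable l2 : int.
Hypothesis hl2 : l2 = 1 \/ l2 = - 1.
Local Notation R := (R3 0 l2).
Local Notation mon := (mon 0 l2).
Local Notation aff := (aff l2).
Local Notation D := (sdprod (der_action hl2)).

Lemma der0 (d : der 0 l2) : d 0 = 0.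
Proof.
by apply: (addrI (d 0)); rewrite addr0 -[RHS](congr1 d (addr0 0)) derD mon0 mulr1.
Qed.

(** The element [(d, (U, b))] acts as the automorphism [(r, v) |-> (alpha r, b v)]
    followed by the automorphism [(r, v) |-> (r + d v, v)]. *)
Definition der_aut (x : D) (g : aff) : aff :=
  (alpha x.2 g.1 + x.1 (Kval x.2.2 *m g.2), Kval x.2.2 *m g.2).

Lemma der_aut_morph x : {morph der_aut x : g h / (g * h)%g}.
Proof.
move=> [r v] [q w]; rewrite /der_aut !affM /= mulmxDr; congr (_, _).
rewrite derD /alpha rmorphD rmorphM /= ract_mon !mulrDr !mulrDl -!addrA.
by congr (_ + _); rewrite addrCA mulrA.
Qed.

Lemma der_aut1 g : der_aut 1%g g = g.
Proof.
case: g => r v; rewrite -[LHS]/(1 * ract hl2 1%g r + 0, 1%:M *m v).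
by rewrite mul1r ract1 mul1mx addr0.
Qed.

Lemma der_autM x y g : der_aut (x * y)%g g = der_aut x (der_aut y g).
Proof.
case: g => r v; case: x => d [U b]; case: y => e [V c].
pose w := Kval b *m Kval c *m v.
rewrite -[LHS]/(unitg_val U * ract hl2 b (unitg_val V) * ract hl2 (b * c)%g r +
  (d w + unitg_val U * ract hl2 b (e (Kval b^-1%g *m w))), w).
rewrite -[RHS]/(unitg_val U * ract hl2 b (unitg_val V * ract hl2 c r +
  e (Kval c *m v)) + d (Kval b *m (Kval c *m v)), Kval b *m (Kval c *m v)).
rewrite {}/w -mulmxA (mulmxA (Kval b^-1%g)) -[Kval b^-1%g *m _]/(Kval (b^-1 * b)%g).
rewrite mulVg mul1mx ractM rmorphD rmorphM /= mulrDr !mulrA -!addrA.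
by rewrite (addrC (d _)).
Qed.

Lemma der_autP x : `[< bijective (der_aut x) /\
  {morph der_aut x : g h / (g * h)%g} >].
Proof.
apply/asboolP; split; last exact: der_aut_morph.
by exists (der_aut x^-1%g) => g; rewrite -der_autM ?mulVg ?mulgV der_aut1.
Qed.

Definition der_autg (x : D) : autg aff := Autg (der_autP x).

Lemma der_autgM : {morph der_autg : x y / (x * y)%g}.
Proof. by move=> x y; apply: autgP => g; exact: der_autM. Qed.

Lemma Kgrp_eq (b c : Kgrp l2) :
  (forall v : 'cV_2, Kval b *m v = Kval c *m v) -> b = c.
Proof.
move=> bc; apply/val_inj/matrixP => i j.
by have /matrixP/(_ i 0) := bc (delta_mx j 0); rewrite -!colE !mxE.
Qed.

Lemma der_autg_inj : injective der_autg.
Proof.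
move=> [d [U b]] [e [V c]] /(congr1 (@autg_fun _)) /= E.
have {}E g : der_aut (d, (U, b)) g = der_aut (e, (V, c)) g by rewrite E.
have bc : b = c by apply: Kgrp_eq => v; have /(congr1 snd) := E (0, v).
rewrite -{c}bc in E *; congr (_, (_, _)).
  apply: derP => v; have /(congr1 fst) := E (0, Kval (b^-1)%g *m v).
  rewrite /= /alpha !rmorph0 !mulr0 !add0r mulmxA.
  by rewrite -[Kval _ *m Kval _]/(Kval (b * b^-1)%g) mulgV mul1mx.
apply: val_inj; have /(congr1 fst) := E (1, 0).
by rewrite /= /alpha /= !rmorph1 !mulr1 mulmx0 !der0 !addr0.
Qed.

(** Since [t] and [t + l2] differ by [l2], one of them differs from 1 by the
    other up to sign: [(t + 1) - 1 = t] and [t - 1]. *)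
Lemma unit_difference : exists v, 1 - mon v \is a GRing.unit.
Proof.
case: hl2 => l2E.
  exists (delta_mx 1 0); rewrite mon_e2 l2E opprD addrCA subrr addr0 unitrN.
  by have := R3t1_unit 0 l2; rewrite addr0 l2E.
exists (delta_mx 0 0); rewrite mon_e1 -opprB unitrN.
by have := R3t2_unit 0 l2; rewrite l2E.
Qed.

(** The translations are the commutators, which makes them characteristic. The
    commutator of [(r, 0)] and [(0, v)] is the translation by [r (1 - mon v)],
    and [1 - mon v] can be chosen invertible. *)
Lemma translation_commutator (g : aff) :
  g.2 = 0 <-> exists x y : aff, (x * y = g * (y * x))%g.
Proof.
split=> [g0|[x [y /(congr1 snd)]]]; last first.
  rewrite !affM /= (addrC y.2) => E; apply: (addIr (x.2 + y.2)).
  by rewrite add0r.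
have [v vU] := unit_difference.
exists ((g.1 / (1 - mon v), 0) : aff), ((0, v) : aff).
rewrite !affM /= g0 mon0 !mul0r !addr0 !add0r mulr1; congr (_, _).
apply: (@subIr _ (g.1 / (1 - mon v) * mon v)); rewrite addrK.
by rewrite -{1}[_ / _]mulr1 -mulrBr divrK.
Qed.

Lemma autg_translation (u : autg aff) (g : aff) : g.2 = 0 -> (u g).2 = 0.
Proof.
move/translation_commutator => [x [y E]]; apply/translation_commutator.
by exists (u x), (u y); rewrite -!autgM E.
Qed.

(** An automorphism [u] preserves the translations, so it has the form
    [(r, v) |-> (f r + d v, B v)] with [f] and [B] additive, and compatibility
    with the product forces [f (r * mon v) = f r * mon (B v)]. As monomials span,
    [f 1] divides every value of [f], hence is a unit, and [sg = f / f 1] is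
    multiplicative. This ring endomorphism sends [t] and [t + l2] to monomials
    whose difference is again [l2], so [B] is in K and [sg] is the induced
    automorphism of the localization. *)
Lemma der_autg_surj (u : autg aff) : exists x, der_autg x = u.
Proof.
pose f r := (u (r, 0)).1; pose d v := (u (0, v)).1; pose B v := (u (0, v)).2.
have u_r r : u (r, 0) = (f r, 0).
  by rewrite [LHS]surjective_pairing (@autg_translation u (r, 0)).
have u_v v : u (0, v) = (d v, B v) by rewrite [LHS]surjective_pairing.
have uE r v : u (r, v) = (f r + d v, B v).
  have -> : (r, v) = (((r, 0) : aff) * ((0, v) : aff))%g :> aff.
    by rewrite affM /= mul0r addr0 add0r.
  by rewrite autgM u_r u_v affM /= mon0 mulr1 add0r.
have fB : zmod_morphism f.
  move=> r q; apply: (addIr (f q)); rewrite subrK.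
  have /(congr1 fst) := autgM u ((r - q, 0) : aff) ((q, 0) : aff).
  by rewrite !u_r !affM /= mon0 !mulr1 subrK addr0 u_r.
have BD v w : B (v + w) = B v + B w.
  have /(congr1 snd) := autgM u ((0, v) : aff) ((0, w) : aff).
  by rewrite !u_v !affM /= mul0r addr0 u_v.
have dD v w : d (v + w) = d v + d w * mon (B v).
  have /(congr1 fst) := autgM u ((0, v) : aff) ((0, w) : aff).
  by rewrite !u_v !affM /= mul0r addr0 u_v.
have fmon r v : f (r * mon v) = f r * mon (B v).
  have /(congr1 fst) := autgM u ((0, v) : aff) ((r, 0) : aff).
  rewrite u_v u_r !affM /= add0r addr0 uE /= addrC; exact: addrI.
have fD r q : f (r + q) = f r + f q.
  have fN x : f (- x) = - f x.
    have f0 : f 0 = 0 by have := fB 0 0; rewrite !subrr.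
    by rewrite -sub0r fB f0 sub0r.
  by rewrite -[q in LHS]opprK fB fN opprK.
(* f takes the value 1, because the inverse of u preserves translations too *)
have f1U : f 1 \is a GRing.unit.
  have f_mul x : exists y, f x = f 1 * y.
    elim/(@mon_span l2): x => [x y [x' xE] [y' yE]|v].
      by exists (x' - y'); rewrite fB xE yE mulrBr.
    by exists (mon (B v)); rewrite -fmon mul1r.
  pose g := autg_inv u ((1, 0) : aff).
  have g2 : g.2 = 0 by apply: autg_translation.
  have fg : f g.1 = 1.
    have /(congr1 fst) : u (g.1, 0) = (1, 0).
      by rewrite -[in RHS](autg_invK u (1, 0)) -/g -g2 -surjective_pairing.
    by [].
  have [y fy] := f_mul g.1; apply/unitrPr; exists y.
  by rewrite -fy.
pose sg r := (f 1)^-1 * f r.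
have sgmon r v : sg (r * mon v) = sg r * mon (B v).
  by rewrite /sg fmon mulrA.
have sg1 : sg 1 = 1 by rewrite /sg mulVr.
have sgB : zmod_morphism sg by move=> x y; rewrite /sg fB mulrBr.
have sgM : monoid_morphism sg.
  split=> // x y; elim/(@mon_span l2): y => [y z yE zE|v].
    by rewrite mulrBr !sgB yE zE mulrBr.
  by rewrite sgmon -[mon v in RHS]mul1r sgmon sg1 mul1r.
pose s := HB.pack_for {rmorphism R -> R} sg
  (GRing.isZmodMorphism.Build _ _ sg sgB)
  (GRing.isMonoidMorphism.Build _ _ sg sgM).
have smon v : s (mon v) = mon (B v) by rewrite -[mon v]mul1r [LHS]sgmon sg1 mul1r.
have [b b0 b1] : exists2 b : Kgrp l2,
    Kval b *m delta_mx 0 0 = B (delta_mx 0 0) &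
    Kval b *m delta_mx 1 0 = B (delta_mx 1 0).
  apply: mon_exponents => //.
  by rewrite -!smon mon_e1 mon_e2 rmorphD rmorph_int.
have BZ n v : B (n *: v) = n *: B v.
  have B0 : B 0 = 0 by apply: (addrI (B 0)); rewrite -BD !addr0.
  have BN w : B (- w) = - B w by apply: (addIr (B w)); rewrite -BD !addNr.
  elim: n => [|n IHn|n IHn]; first by rewrite !scale0r.
    have -> : n.+1%:Z = n%:Z + 1 by lia.
    by rewrite !scalerDl BD IHn !scale1r.
  have -> : - n.+1%:Z = - n%:Z - 1 by lia.
  by rewrite !scalerBl BD IHn !scale1r BN.
have BE v : B v = Kval b *m v.
  by rewrite [v]colE2 BD !BZ mulmxDr -!scalemxAr b0 b1.
have fE r : f r = f 1 * ract hl2 b r.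
  rewrite (@ract_uniq _ hl2 b s); first by rewrite /= /sg mulrA mulrV // mul1r.
  by move=> v; rewrite smon BE.
(* d is a derivation for the action twisted by b, and e undoes the twist *)
pose e v := d (Kval b^-1%g *m v).
have eP : `[< forall v w, e (v + w) = e v + e w * mon v >].
  apply/asboolP => v w; rewrite /e mulmxDr dD BE mulmxA.
  by rewrite -[Kval b *m _]/(Kval (b * b^-1)%g) mulgV mul1mx.
exists (Der eP, (Unitg f1U, b)); apply: autgP => -[r v].
rewrite uE BE /= /der_aut /alpha /= -fE /e mulmxA.
by rewrite -[Kval _ *m Kval _]/(Kval (b^-1 * b)%g) mulVg mul1mx.
Qed.

Lemma aut_aff : isomorphic_groups (autg aff) D.
Proof.
apply: isomorphic_groups_sym.
exact: isomorphic_groups_inj_surj der_autgM der_autg_inj der_autg_surj.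
Qed.

End AffineAutomorphisms.

(** * Baumslag's group is the affine group *)

Section BMGNormalForm.
Local Open Scope group_scope.

Definition bmg (w : word 'I_3) : BMG := (\pi_(presented BMG_rels) w)%qT.
Definition bmg_a : BMG := bmg BMG_a.
Definition bmg_s : BMG := bmg BMG_s.
Definition bmg_t : BMG := bmg BMG_t.

Lemma bmg_cat u v : bmg (u ++ v) = bmg u * bmg v.
Proof. by rewrite [RHS]presented_mulE. Qed.

Lemma bmg_inv u : bmg (inv_word u) = (bmg u)^-1.
Proof. by rewrite [RHS]presented_invE. Qed.

Lemma bmg_conj u v : bmg (conj_word u v) = bmg u ^ (bmg v)^-1.
Proof. by rewrite /conj_word !bmg_cat bmg_inv conjgE invgK. Qed.

Lemma bmg_rel u v : (u, v) \in BMG_rels -> bmg u = bmg v.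
Proof. by move=> uvR; apply/pres_piE/(pres_rel uvR). Qed.

Lemma bmg_st : commute bmg_s bmg_t.
Proof.
by rewrite /commute -!bmg_cat; apply: bmg_rel; rewrite !inE eqxx.
Qed.

Lemma bmg_aat : commute bmg_a (bmg_a ^ bmg_t^-1).
Proof.
have : (comm_word BMG_a (conj_word BMG_a BMG_t), [::]) \in BMG_rels.
  by rewrite !inE eqxx orbT.
move/bmg_rel; rewrite /comm_word 2!bmg_cat bmg_conj bmg_cat !bmg_inv bmg_conj.
rewrite -/bmg_a -/bmg_t.
move: bmg_a (bmg_a ^ _) => x y E.
by apply: divg1_eq; rewrite invgM -mulgA; exact: E.
Qed.

Lemma bmg_aas : bmg_a * bmg_a ^ bmg_s^-1 = bmg_a ^ bmg_t^-1.
Proof.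
by rewrite -!bmg_conj -bmg_cat; apply: bmg_rel; rewrite !inE eqxx !orbT.
Qed.

Lemma ord3P (i : 'I_3) : [\/ i = inord 0, i = inord 1 | i = inord 2].
Proof.
case: i => [[|[|[|//]]] ?]; [constructor 1 | constructor 2 | constructor 3];
  by apply: val_inj; rewrite /= inordK.
Qed.

(** The set of normal forms contains 1 and is stable under left multiplication by
    the letters. *)
Lemma bmg_normal_form (x : BMG) :
  exists p i j k l, x = normal_form bmg_a bmg_s bmg_t p i j k l.
Proof.
elim/quotW: x => w; rewrite -/(bmg w).
elim: w => [|[i b] w [p [j [k [m [n IHw]]]]]].
  exists 0%R, 0%N, 0%N, 0%R, 0%R.
  by rewrite /normal_form poly_power0 conj1g !mulg1.
rewrite -cat1s bmg_cat IHw.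
have letterN x : bmg [:: (x, true)] = (bmg [:: (x, false)])^-1 by rewrite -bmg_inv.
case: (ord3P i) => ->.
- pose c : int := (if b then - 1 else 1)%R.
  have [q E] := mul_a_normal_form bmg_st bmg_aat bmg_aas c p j k m n.
  by exists q, j, k, m, n; rewrite -E /c; case: (b) => //; rewrite letterN.
- case: b; last by do 5 eexists; exact: mul_s_normal_form bmg_st _ _ _ _ _.
  by rewrite letterN; do 5 eexists; exact: mul_sV_normal_form bmg_st _ _ _ _ _.
- case: b.
    by rewrite letterN; do 5 eexists; exact: mul_tV_normal_form bmg_st _ _ _ _ _.
  by do 5 eexists; exact: mul_t_normal_form bmg_st bmg_aat bmg_aas _ _ _ _ _.
Qed.

End BMGNormalForm.

Section BMGAffine.
Variable l2 : int.
Hypothesis hl2 : l2 = 1 \/ l2 = - 1.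
Local Notation R := (R3 0 l2).
Local Notation mon := (mon 0 l2).
Local Notation aff := (aff l2).

(** The relation [a a^s = a^t] asks for monomials with [1 + mon dir_s = mon dir_t].
    For [l2 = 1] these are [t] and [t + 1], but for [l2 = -1] they are [t - 1] and
    [t], so the two generators of Z^2 exchange their roles. *)
Definition dir_s : 'cV[int]_2 := if l2 == 1 then delta_mx 0 0 else delta_mx 1 0.
Definition dir_t : 'cV[int]_2 := if l2 == 1 then delta_mx 1 0 else delta_mx 0 0.

Lemma mon_dir : 1 + mon dir_s = mon dir_t.
Proof.
rewrite /dir_s /dir_t; case: hl2 => E; rewrite E /=.
  by rewrite mon_e1 mon_e2 addrC.
by rewrite mon_e1 mon_e2 addrC subrK.
Qed.

Lemma dir_free (k l : int) : k *: dir_s + l *: dir_t = 0 -> k = 0 /\ l = 0.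
Proof.
move/matrixP => E; have := E 0 0; have := E 1 0; rewrite /dir_s /dir_t.
by case: ifP => _; rewrite !mxE /=; split; lia.
Qed.

Lemma dir_span (v : 'cV[int]_2) : exists k l : int, v = k *: dir_s + l *: dir_t.
Proof.
rewrite /dir_s /dir_t; case: ifP => _.
  by exists (v 0 0), (v 1 0); exact: colE2.
by exists (v 1 0), (v 0 0); rewrite addrC; exact: colE2.
Qed.

Lemma horner_dir_s_inj : injective (fun p => (map_poly intr p).[mon dir_s]).
Proof.
rewrite /dir_s; case: hl2 => l2E p q; rewrite l2E /=.
  by rewrite mon_e1 -!R3poly_horner => /R3poly_inj.
have E r : (map_poly intr r).[Defs.mon 0 (- 1) (delta_mx 1 0)] =
    R3poly 0 (- 1) (r \Po ('X + (- 1)%:P)).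
  rewrite mon_e2 R3poly_horner map_comp_poly horner_comp.
  by rewrite rmorphD /= map_polyX map_polyC !hornerE.
rewrite !E => /R3poly_inj/(congr1 (comp_poly ('X - (- 1)%:P))).
by rewrite !comp_polyXaddC_K.
Qed.

Definition aff_a : aff := (1, 0).
Definition aff_s : aff := (0, dir_s).
Definition aff_t : aff := (0, dir_t).

Definition aff_gen (i : 'I_3) : aff :=
  if i == inord 0 then aff_a else if i == inord 1 then aff_s else aff_t.

Definition bmg_aff : BMG -> aff := @pres_lift _ BMG_rels aff aff_gen.

Lemma aff_conj r (x : aff) : (((r, 0) : aff) ^ x)%g = (r * mon (- x.2), 0) :> aff.
Proof.
rewrite conjgE affV !affM /= mon0 mulr1 add0r addNr; congr (_, _).
by rewrite mulrDl addrCA -mulrDl addNr mul0r addr0.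
Qed.

Lemma aff_rels r : r \in BMG_rels -> eval_word aff_gen r.1 = eval_word aff_gen r.2.
Proof.
have [ga gs gt] : [/\ eval_word aff_gen BMG_a = aff_a,
    eval_word aff_gen BMG_s = aff_s & eval_word aff_gen BMG_t = aff_t].
  rewrite /= !mulg1 /eval_letter /aff_gen /= !eqxx.
  by split=> //; rewrite -val_eqE /= !inordK //= -val_eqE /= !inordK.
have gc u v : eval_word aff_gen (conj_word u v) =
    (eval_word aff_gen u ^ (eval_word aff_gen v)^-1)%g.
  by rewrite /conj_word !eval_word_cat eval_inv_word conjgE invgK.
have rel_st : eval_word aff_gen (BMG_s ++ BMG_t) = eval_word aff_gen (BMG_t ++ BMG_s).
  by rewrite !eval_word_cat gs gt !affM /= !mul0r !addr0 addrC.
have rel_aat : eval_word aff_gen (comm_word BMG_a (conj_word BMG_a BMG_t)) = 1%g.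
  rewrite /comm_word 2!eval_word_cat gc eval_word_cat !eval_inv_word gc ga gt.
  rewrite aff_conj !affV !affM /= !oppr0 !addr0 mon0 !mulr1 addrA -opprD subrr.
  by [].
have rel_aas : eval_word aff_gen (BMG_a ++ conj_word BMG_a BMG_s) =
    eval_word aff_gen (conj_word BMG_a BMG_t).
  rewrite eval_word_cat !gc ga gs gt !aff_conj affM affV /= mon0 !mulr1 !mul1r.
  by rewrite !opprK mon_dir addr0.
by rewrite !inE => /or3P[] /eqP ->; [exact: rel_st|exact: rel_aat|exact: rel_aas].
Qed.

Lemma bmg_affM : {morph bmg_aff : x y / (x * y)%g}.
Proof. exact: (pres_liftM aff_rels). Qed.

Lemma bmg_aff1 : bmg_aff 1%g = 1%g.
Proof. by apply: (mulgI (bmg_aff 1%g)); rewrite -bmg_affM !mulg1. Qed.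

Lemma bmg_affV x : bmg_aff x^-1%g = (bmg_aff x)^-1%g.
Proof. by apply: (mulIg (bmg_aff x)); rewrite -bmg_affM !mulVg bmg_aff1. Qed.

Lemma bmg_aff_conj x y : bmg_aff (x ^ y)%g = (bmg_aff x ^ bmg_aff y)%g.
Proof. by rewrite !conjgE !bmg_affM bmg_affV. Qed.

Lemma bmg_aff_gen :
  [/\ bmg_aff bmg_a = aff_a, bmg_aff bmg_s = aff_s & bmg_aff bmg_t = aff_t].
Proof.
rewrite /bmg_aff !(pres_liftE aff_rels) /= !mulg1 /eval_letter /aff_gen /= !eqxx.
by split=> //; rewrite -val_eqE /= !inordK //= -val_eqE /= !inordK.
Qed.

Lemma bmg_aff_poly_power p :
  bmg_aff (poly_power bmg_a bmg_s p) = ((map_poly intr p).[mon dir_s], 0).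
Proof.
have [fa fs _] := bmg_aff_gen.
elim/poly_ind: p => [|p c IHp].
  by rewrite poly_power0 rmorph0 horner0 bmg_aff1.
rewrite poly_powerXaddC bmg_affM bmg_aff_conj bmg_affV IHp fs aff_conj affV /= opprK.
rewrite (zpow_morph _ _ bmg_affM) fa zpow_translation affM /= mon0 mulr1 addr0.
by rewrite rmorphD rmorphM /= map_polyX map_polyC !hornerE addrC.
Qed.

(** A normal form in the kernel has a vanishing numerator, and its component in
    Z^2 is zero, so it is trivial. *)
Lemma bmg_aff_inj : injective bmg_aff.
Proof.
have [fa fs ft] := bmg_aff_gen.
suff ker x : bmg_aff x = 1%g -> x = 1%g.
  move=> x y E; apply: divg1_eq; apply: ker; apply: (mulIg (bmg_aff y)).
  by rewrite -bmg_affM mulgVK mul1g.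
have [p [i [j [k [l ->]]]]] := bmg_normal_form x; rewrite /normal_form.
set g := (bmg_s ^+ i * bmg_t ^+ j)%g; rewrite 2!bmg_affM.
rewrite !(zpow_morph _ _ bmg_affM) fs ft !zpow_linear.
rewrite bmg_aff_conj bmg_aff_poly_power aff_conj !affM /= !mul0r !addr0 add0r.
have gU := mon_unit 0 l2 (- (bmg_aff g).2).
rewrite aff1 => E; have /dir_free[-> ->] := congr1 snd E.
have pg0 : (map_poly intr p).[mon dir_s] * mon (- (bmg_aff g).2) = 0.
  by have := congr1 fst E.
rewrite (_ : p = 0) ?poly_power0 ?conj1g ?mulg1 //.
by apply/horner_dir_s_inj/(mulIr gU); rewrite pg0 rmorph0 horner0 mul0r.
Qed.

(** The conjugates of [a] map onto the translations by monomials, which generate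
    all translations. *)
Lemma bmg_aff_surj y : exists x, bmg_aff x = y.
Proof.
have [fa fs ft] := bmg_aff_gen.
have lin v : exists x, bmg_aff x = (0, v).
  have [k [l ->]] := dir_span v; exists (zpow bmg_s k * zpow bmg_t l)%g.
  rewrite bmg_affM !(zpow_morph _ _ bmg_affM) fs ft !zpow_linear affM /=.
  by rewrite mul0r addr0.
have trans r : exists x, bmg_aff x = (r, 0).
  elim/(@mon_span l2): r => [r q [x xE] [z zE]|v].
    exists (x * z^-1)%g; apply: (mulIg (bmg_aff z)).
    by rewrite -bmg_affM mulgVK zE affM /= xE mon0 mulr1 subrK addr0.
  have [x xE] := lin v; exists (bmg_a ^ x^-1)%g.
  by rewrite bmg_aff_conj bmg_affV fa xE aff_conj affV /= opprK mul1r.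
case: y => r v; have [x xE] := trans r; have [z zE] := lin v.
by exists (x * z)%g; rewrite bmg_affM xE zE affM /= mul0r addr0 add0r.
Qed.

Lemma bmg_aff_isomorphic : isomorphic_groups BMG aff.
Proof.
exact: isomorphic_groups_inj_surj bmg_affM bmg_aff_inj bmg_aff_surj.
Qed.

End BMGAffine.

Theorem theorem5p1 (l2 : int) (hl2 : l2 = 1 \/ l2 = - 1) :
  isomorphic_groups (autg BMG) (sdprod (der_action hl2)).
Proof.
apply: isomorphic_groups_trans (aut_aff hl2).
exact/autg_isomorphic/bmg_aff_isomorphic.
Qed.
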